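(* There are exactly twenty-four quasiparabolic Gelfand models in type $B_3$. Eight of them are the following four families and their $\omega$-twists: \[ \{C,\delta D\},\qquad \{C,B_\delta,B_\omega\},\qquad \{B_\varepsilon,E_\delta,\mathbf 1,\omega\},\qquad \{E_\omega,B_{\mathbf 1},\delta,\varepsilon\}. \] These eight have perfect realizations. The other sixteen are the following eight families and their $\omega$-twists (each family and its $\omega$-twist being distinct): \[ \begin{array}{c|l} \mathscr N_1&F_{\mathbf 1},F_\varepsilon,B_\delta,B_\omega\\ \mathscr N_2&F_{\mathbf 1},F_\varepsilon,\delta D\\ \mathscr N_3&F_{\mathbf 1},E_\delta,A_\varepsilon,\omega\\ \mathscr N_4&F_{\mathbf 1},E_\delta,A_\omega,\varepsilon\\ \mathscr N_5&B_\varepsilon,E_\delta,L_+\\ \mathscr N_6&E_\omega,F_\varepsilon,A_{\mathbf 1},\delta\\ \mathscr N_7&E_\omega,F_\varepsilon,A_\delta,\mathbf 1\\ \mathscr N_8&E_\omega,B_{\mathbf 1},L_- \end{array} \]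
   Context: $W=B_3=N_3\rtimes S_3$ is the group of signed permutations, $N_3=\langle f_1,f_2,f_3\rangle$ with $f_i$ changing the sign of coordinate $i$; simple generators $s_0=f_1$, $s_1=(12)$, $s_2=(23)$; $p:W\to S_3$ the projection. Linear characters: $\varepsilon(w)=(-1)^{\#\{i\in\{1,2,3\}:w(i)<0\}}$, $\delta(w)=\mathrm{sgn}(p(w))$, $\omega=\varepsilon\delta$ (Coxeter sign). $R$ is the degree-three reflection character and $U$ the inflation along $p$ of the degree-two irreducible character of $S_3$. The ten irreducible characters are $\mathbf 1,\delta,\varepsilon,\omega,U,\varepsilon U,R,\varepsilon R,\delta R,\omega R$ (with $\delta U=U$). Put $P=\langle s_1,s_2\rangle$, $z=-I$, $K=P\times\langle z\rangle$, $W^+=\ker\omega$. For $\tau\in\{\mathbf 1,\delta,\varepsilon,\omega\}$ define $A_\tau=\tau(\mathbf 1+U)$, $B_\tau=\tau(\mathbf 1+U+R)$, $E_\tau=\tau(\mathbf 1+U+R+\varepsilon R+\delta R)$, $F_\tau=\tau(\mathbf 1+\varepsilon R)$; these are induced from the restriction of $\tau$ to $N_3\rtimes\langle(12)\rangle$, $\langle s_0,s_1\rangle$, $\langle s_0,s_2\rangle$, $K$ respectively. Further $C=\mathbf 1+\varepsilon+R+\varepsilon R=\mathrm{Ind}_P^W\mathbf 1$, $D=\mathbf 1+\varepsilon+U+\varepsilon U+R+\varepsilon R=\mathrm{Ind}_{\langle(12),f_1f_2\rangle}^W\mathbf 1$, $L_+=\mathbf 1+\omega=\mathrm{Ind}_{W^+}^W\mathbf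 1$, $L_-=\delta+\varepsilon=\mathrm{Ind}_{W^+}^W(\delta|_{W^+})$. The $\omega$-twist of a family multiplies each member by $\omega$. For a finite Coxeter system $(W,S)$ with length $\ell$, reflections $T=\{wsw^{-1}\}$, $W_J=\langle J\rangle$: a scaled $W$-set is a $W$-set $X$ with $h:X\to\mathbb Z$ such that $|h(sx)-h(x)|\le 1$ for $s\in S$. It is quasiparabolic (QP) if for all $x\in X$, $r\in T$, $s\in S$: (QP1) $h(rx)=h(x)$ implies $rx=x$; (QP2) $h(rx)>h(x)$ and $h(srx)<h(sx)$ imply $rx=sx$. A subgroup $H\le W_J$ is quasiparabolic if $W_J/H$ with $h(wH)=\min_{u\in wH}\ell(u)$ is quasiparabolic for $(W_J,J)$. An allowed character is $\mathrm{Ind}_H^W(\sigma|_H)$ with $J\subseteq S$, $H\le W_J$ quasiparabolic, $\sigma$ a one-dimensional complex character of $W_J$. A quasiparabolic Gelfand model is an unordered family (multiset) of allowed characters with sum $\Gamma_W=\sum_{\rho\in\mathrm{Irr}(W)}\rho$; families are identified if their individual induced characters agree after reordering. A perfect involution of a Coxeter group is an element $z$ of its semidirect product with its group of diagram automorphisms such that $z^2=1$ and $(zt)^4=1$ for every reflection $t$. A family has a perfect realization if its terms can be written as $\mathrm{Ind}_H^W(\sigma|_H)$, $\sigma\in\mathrm{Lin}(W_J)$, with $H$ the centralizer in $W_J$ of a perfect involution for $W_J$ that is of minimal length in its $W_J$-conjugacy class (such centralizers are quasiparabolic). *)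

(* Defs.v *)
From HB Require Import structures.
From mathcomp Require Import all_boot all_order all_fingroup all_algebra.
From mathcomp Require Import all_solvable all_field all_character.
From mathcomp Require Import zify.

Set Implicit Arguments.
Unset Strict Implicit.
Unset Printing Implicit Defensive.

Import GroupScope GRing.Theory Num.Theory.
Local Open Scope ring_scope.

(* A finite Coxeter system is given by its set S of simple generators inside  *)
(* an ambient finite group; the Coxeter group itself is <<S>>.  Below, W is   *)
(* meant to be <<S>>, and is a separate argument only to fix the type of the  *)
(* class functions (for B3 see [B3_gen]).                                     *)
Section CoxeterSystem.

Variable gT : finGroupType.
Implicit Types (S J : {set gT}) (H : {group gT}).

(* [S ^+ n] is the set of products of n elements of S.  Since S generates,    *)
(* an element of <<S>> has length < #|gT|.                                    *)
Definition cox_length S (w : gT) : nat :=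
  find (fun n => w \in (S ^+ n)%g) (iota 0 #|gT|).

Definition reflections S : {set gT} := class_support S <<S>>.

Record scaled_set S (X : finType) (A : {set X}) (act : gT -> X -> X)
    (h : X -> int) : Prop := ScaledSet {
  scaled_stable : forall w x, w \in <<S>> -> x \in A -> act w x \in A;
  scaled_act1 : forall x, x \in A -> act 1%g x = x;
  scaled_actM : forall v w x, v \in <<S>> -> w \in <<S>> -> x \in A ->
    act (v * w)%g x = act v (act w x);
  scaled_height : forall s x, s \in S -> x \in A ->
    `|h (act s x) - h x| <= 1
}.

Record quasiparabolic S (X : finType) (A : {set X}) (act : gT -> X -> X)
    (h : X -> int) : Prop := Quasiparabolic {
  qp_scaled : scaled_set S A act h;
  qp1 : forall x r, x \in A -> r \in reflections S ->
    h (act r x) = h x -> act r x = x;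
  qp2 : forall x r s, x \in A -> r \in reflections S -> s \in S ->
    h x < h (act r x) -> h (act s (act r x)) < h (act s x) ->
    act r x = act s x
}.

(* The default value #|gT| exceeds all lengths, so it plays no role when X is *)
(* a nonempty subset of <<S>>.                                                *)
Definition coset_height S (X : {set gT}) : int :=
  (\big[minn/#|gT|]_(u in X) cox_length S u)%N%:Z.

Definition quasiparabolic_subgroup J H : Prop :=
  H \subset <<J>> /\
  quasiparabolic J (lcosets H <<J>>) (fun w X => w *: X)%g (coset_height J).

(* Characters of finite groups take values in the algebraic numbers, so       *)
(* class functions with values in [algC] lose nothing over complex ones.      *)
Definition allowed_character (W : {group gT}) S (phi : 'CF(W)) : Prop :=
  exists (J : {set gT}) (H : {group gT}) (sigma : 'CF(<<J>>)),
    [/\ J \subset S, quasiparabolic_subgroup J H,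
        sigma \is a linear_char & phi = 'Ind[W, H] ('Res[H, <<J>>] sigma)].

(* Families are sequences, to be compared up to [perm_eq]. *)
Definition qp_gelfand_model (W : {group gT}) S (F : seq 'CF(W)) : Prop :=
  (forall phi, phi \in F -> allowed_character S phi) /\
  \sum_(phi <- F) phi = \sum_(i : Iirr W) 'chi_i.

(* Diagram automorphisms, as the automorphisms of the Coxeter group that      *)
(* permute its simple generators.                                             *)
Definition diagram_aut J : {set {perm gT}} :=
  [set a in Aut <<J>> | a @: J == J].

Lemma diagram_aut_group_set J : group_set (diagram_aut J).
Proof.
apply/group_setP; split=> [|a b].
  rewrite inE group1 /=; apply/eqP/setP=> x.
  apply/imsetP/idP => [[y Jy ->]|Jx]; first by rewrite perm1.
  by exists x; rewrite ?perm1.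
rewrite inE => /andP[Aa /eqP aJ]; rewrite inE => /andP[Ab /eqP bJ].
rewrite inE groupM //=.
have ->: (a * b)%g @: J = b @: (a @: J).
  by rewrite -imset_comp; apply: eq_imset => x; rewrite /= permM.
by rewrite aJ bJ.
Qed.

Canonical diagram_aut_group J := Group (diagram_aut_group_set J).

Lemma diagram_aut_sub J : diagram_aut J \subset Aut <<J>>.
Proof. by apply/subsetP=> a; rewrite inE => /andP[]. Qed.

Definition diagram_action J : groupAction (diagram_aut J) <<J>> :=
  ([Aut <<J>>] \ diagram_aut_sub J)%gact.

(* <<J>> inside its semidirect product with the diagram automorphisms. *)
Definition cox_inj J (w : gT) : sdprod_by (diagram_action J) :=
  sdpair1 (diagram_action J) w.

Definition perfect_involution J (z : sdprod_by (diagram_action J)) : Prop :=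
  (z ^+ 2 = 1)%g /\
  (forall t, t \in reflections J -> ((z * cox_inj J t) ^+ 4 = 1)%g).

(* Elements of [sdprod_by] are pairs (automorphism, group element).  Diagram  *)
(* automorphisms have length 0 and preserve the length of <<J>>.              *)
Definition ext_length J (z : sdprod_by (diagram_action J)) : nat :=
  cox_length J z.2.

Definition minimal_in_class J (z : sdprod_by (diagram_action J)) : Prop :=
  forall w, w \in <<J>> -> (ext_length z <= ext_length (z ^ cox_inj J w)%g)%N.

Definition perfect_centralizer J (z : sdprod_by (diagram_action J)) :
    {group gT} :=
  (sdpair1 (diagram_action J) @*^-1 'C[z])%G.

Definition perfect_character (W : {group gT}) S (phi : 'CF(W)) : Prop :=
  exists (J : {set gT}) (z : sdprod_by (diagram_action J))
         (sigma : 'CF(<<J>>)),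
    let H := perfect_centralizer z in
    [/\ J \subset S, perfect_involution z, minimal_in_class z,
        sigma \is a linear_char & phi = 'Ind[W, H] ('Res[H, <<J>>] sigma)].

Definition has_perfect_realization (W : {group gT}) S (F : seq 'CF(W)) : Prop :=
  forall phi, phi \in F -> perfect_character S phi.

End CoxeterSystem.

(* Signed permutations, acting on {+1,+2,+3,-1,-2,-3}: the point (b, i)       *)
(* stands for the (i+1)-st coordinate, negated when b is true.                *)
Definition spoint : finType := (bool * 'I_3)%type.

Definition spoint_opp (x : spoint) : spoint := (~~ x.1, x.2).

Lemma spoint_opp_inj : injective spoint_opp.
Proof. by move=> [b i] [c j] [] /negb_inj-> ->. Qed.

Definition minus_id : {perm spoint} := perm spoint_opp_inj.

Definition B3 : {group {perm spoint}} := 'C[minus_id]%G.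

Definition sflip (i : 'I_3) : {perm spoint} := tperm (false, i) (true, i).

Definition splift_fun (s : 'S_3) (x : spoint) : spoint := (x.1, s x.2).

Lemma splift_inj s : injective (splift_fun s).
Proof. by move=> [b i] [c j] [] -> /perm_inj->. Qed.

Definition splift (s : 'S_3) : {perm spoint} := perm (@splift_inj s).

Definition coord (k : nat) : 'I_3 := inord k.

Definition B3_s0 : {perm spoint} := sflip (coord 0).
Definition B3_s1 : {perm spoint} := splift (tperm (coord 0) (coord 1)).
Definition B3_s2 : {perm spoint} := splift (tperm (coord 1) (coord 2)).

Definition B3_S : {set {perm spoint}} := [set B3_s0; B3_s1; B3_s2].

Lemma B3P (w : {perm spoint}) : reflect (forall b i, w (~~ b, i) = spoint_opp (w (b, i)))
  (w \in B3).
Proof.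
apply: (iffP cent1P) => [cw b i | cw].
  by have /permP/(_ (b, i)) := cw; rewrite !permM !permE.
by apply/permP=> -[b i]; rewrite !permM !permE -cw.
Qed.

(* w sends coordinate i to coordinate [sproj_fun w i], negated if [neg w i]. *)
Definition sproj_fun (w : {perm spoint}) (i : 'I_3) : 'I_3 := (w (false, i)).2.
Definition neg (w : {perm spoint}) (i : 'I_3) : bool := (w (false, i)).1.

Lemma B3E (w : {perm spoint}) b i : w \in B3 -> w (b, i) = (b (+) neg w i, sproj_fun w i).
Proof.
move/B3P=> cw; rewrite /neg /sproj_fun; case: b; last by case: (w _).
by rewrite (cw false) /spoint_opp; case: (w _).
Qed.

Lemma sproj_inj (w : {perm spoint}) : w \in B3 -> injective (sproj_fun w).
Proof.
move=> Ww i j eq_ij.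
have: w (neg w i, i) = w (neg w j, j) by rewrite !B3E // !addbb eq_ij.
by move/perm_inj; case.
Qed.

(* [sproj w] is [sproj_fun w] as a permutation; the value outside B3 plays no *)
(* role.                                                                      *)
Definition sproj (w : {perm spoint}) : 'S_3 := 
  insubd (1%g : {perm 'I_3}) (finfun (sproj_fun w)).

Lemma sprojE (w : {perm spoint}) i : w \in B3 -> sproj w i = sproj_fun w i.
Proof.
move=> Ww; rewrite -pvalE /sproj insubdK ?ffunE //.
by apply/injectiveP=> x y; rewrite !ffunE; apply: sproj_inj.
Qed.

Lemma sproj_funM : {in B3 &, forall v w i,
  sproj_fun (v * w)%g i = sproj_fun w (sproj_fun v i)}.
Proof.
by move=> v w Wv Ww i; rewrite {1}/sproj_fun permM (B3E _ _ Wv) (B3E _ _ Ww).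
Qed.

Lemma negM : {in B3 &, forall v w i,
  neg (v * w)%g i = neg v i (+) neg w (sproj_fun v i)}.
Proof.
by move=> v w Wv Ww i; rewrite {1}/neg permM (B3E _ _ Wv) (B3E _ _ Ww).
Qed.

Lemma sprojM : {in B3 &, {morph sproj : v w / (v * w)%g}}.
Proof.
move=> v w Wv Ww; apply/permP=> i.
by rewrite permM !sprojE ?groupM // sproj_funM.
Qed.

Canonical sproj_morphism := Morphism sprojM.

Lemma spliftE s b i : splift s (b, i) = (b, s i).
Proof. by rewrite permE. Qed.

Lemma spliftM : {morph splift : s t / (s * t)%g}.
Proof. by move=> s t; apply/permP=> -[b i]; rewrite permM !spliftE permM. Qed.

Lemma splift_gen (s : 'S_3) : splift s \in <<B3_S>>.
Proof.
have S1 : B3_s1 \in <<B3_S>> by rewrite mem_gen // !inE eqxx orbT.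
have S2 : B3_s2 \in <<B3_S>> by rewrite mem_gen // !inE eqxx orbT.
have lift1 : splift 1 = 1%g.
  by apply/permP=> -[b i]; rewrite spliftE !perm1.
have gS t : t \in <<[set tperm (coord 0) y | y in 'I_3]>>.
  by rewrite gen_tperm inE.
have grp : group_set [set t : 'S_3 | splift t \in <<B3_S>>].
  apply/group_setP; split=> [|t u]; rewrite !inE ?lift1 ?group1 //.
  by rewrite spliftM; apply: groupM.
have S01 : splift (tperm (coord 0) (coord 1)) \in <<B3_S>> by [].
have S02 : splift (tperm (coord 0) (coord 2)) \in <<B3_S>>.
  have -> : tperm (coord 0) (coord 2) =
      (tperm (coord 0) (coord 1) ^ tperm (coord 1) (coord 2))%g.
    rewrite tpermJ tpermL (tpermD (x := coord 1)) -?val_eqE /= ?inordK //.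
  by rewrite conjgE !spliftM tpermV !groupM.
suff: s \in Group grp by rewrite inE.
apply: (subsetP _ _ (gS s)); rewrite gen_subG.
apply/subsetP=> _ /imsetP[y _ ->]; rewrite inE.
have [->|y0] := eqVneq y (coord 0); first by rewrite tperm1 lift1.
have [->|y1] := eqVneq y (coord 1); first by [].
suff -> : y = coord 2 by [].
apply/val_inj; move: y0 y1; rewrite -!val_eqE /= !inordK //.
by case: y => [[|[|[|m]]]].
Qed.

Lemma sflipE k b i : sflip k (b, i) = (b (+) (i == k), i).
Proof.
rewrite /sflip; have [->|ik] := eqVneq i k.
  by case: b; rewrite ?tpermL ?tpermR.
by rewrite addbF tpermD // xpair_eqE [k == i]eq_sym (negPf ik) andbF.
Qed.

Lemma sflip_B3 k : sflip k \in B3.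
Proof. by apply/B3P => b i; rewrite !sflipE addNb. Qed.

Lemma B3_gen : <<B3_S>>%g = B3.
Proof.
apply/eqP; rewrite eqEsubset gen_subG; apply/andP; split; apply/subsetP=> w.
  move=> /setUP[/setUP[]|] /set1P->; first exact: sflip_B3.
    by apply/B3P => b i; rewrite !spliftE.
  by apply/B3P => b i; rewrite !spliftE.
have flipG i : sflip i \in <<B3_S>>.
  have -> : sflip i = (B3_s0 ^ splift (tperm (coord 0) i))%g.
    by rewrite tpermJ !spliftE tpermL.
  by rewrite groupJ ?splift_gen // mem_gen // !inE eqxx.
have [m] := ubnP #|[pred i | neg w i]|.
elim: m w => // m IHm w le_m Ww.
have [i ni | no] := pickP [pred i | neg w i]; last first.
  suff -> : w = splift (sproj w) by apply: splift_gen.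
  apply/permP=> -[b i]; rewrite spliftE sprojE // B3E //.
  by move: (no i) => /= ->; rewrite addbF.
have -> : w = (sflip i * (sflip i * w))%g by rewrite mulgA tperm2 mul1g.
rewrite groupM // IHm ?groupM ?sflip_B3 //.
apply: leq_trans (le_m : _ <= m)%N; apply/proper_card/properP; split.
  apply/subsetP=> j; rewrite !inE negM ?sflip_B3 // /neg /sproj_fun !sflipE /=.
  by have [-> | ji] := eqVneq j i; last by [].
exists i => //; rewrite !inE negM ?sflip_B3 // /neg /sproj_fun !sflipE /= eqxx.
by move: ni; rewrite /= /neg => ->.
Qed.

Notation CF3 := 'CF(B3).

(* The class function with values f w on B3, for f multiplicative on B3. *)
Lemma mult_class_fun (f : {perm spoint} -> algC) :
    {in B3 &, {morph f : v w / (v * w)%g >-> v * w}} ->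
  is_class_fun <<B3>> [ffun w => f w *+ (w \in B3)].
Proof.
move=> fM; rewrite genGid; apply: intro_class_fun => [x y Wx Wy | x /negPf-> //].
rewrite groupJ // Wx conjgE !fM ?groupM ?groupV // mulrCA -fM ?groupV //.
by rewrite mulVg -fM ?group1 // mulg1.
Qed.

Definition eps_fun (w : {perm spoint}) : algC := (-1) ^+ #|[pred i | neg w i]|.

Lemma eps_funM : {in B3 &, {morph eps_fun : v w / (v * w)%g >-> v * w}}.
Proof.
have E w : eps_fun w = \prod_(i : 'I_3) (-1) ^+ neg w i.
  by rewrite /eps_fun -sum1_card -prodrXr big_mkcond; apply: eq_bigr => i _;
     rewrite inE; case: (neg w i).
move=> v w Wv Ww; rewrite !E [X in _ = _ * X](reindex_inj (sproj_inj Wv)).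
by rewrite -big_split; apply: eq_bigr => i _; rewrite /= negM // signr_addb.
Qed.

Definition eps : CF3 := Cfun 0 (mult_class_fun eps_funM).

Definition delta_fun (w : {perm spoint}) : algC := (-1) ^+ (sproj w).

Lemma delta_funM : {in B3 &, {morph delta_fun : v w / (v * w)%g >-> v * w}}.
Proof.
by move=> v w Wv Ww; rewrite /delta_fun sprojM // odd_permM signr_addb.
Qed.

Definition delta : CF3 := Cfun 0 (mult_class_fun delta_funM).

Definition omega : CF3 := eps * delta.

(* The matrix of a signed permutation, acting on row vectors (matching the    *)
(* left-to-right composition of permutations).                                *)
Definition refl_mx (w : {perm spoint}) : 'M[algC]_3 :=
  \matrix_(i, j) ((sproj_fun w i == j)%:R * (-1) ^+ neg w i).

Lemma refl_mx_repr : mx_repr B3 refl_mx.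
Proof.
split=> [|v w Wv Ww].
  by apply/matrixP=> i j; rewrite !mxE /neg /sproj_fun perm1 mulr1.
apply/matrixP=> i j; rewrite !mxE (bigD1 (sproj_fun v i)) //= big1 => [|k].
  rewrite !mxE eqxx mul1r addr0 sproj_funM // negM // signr_addb.
  by rewrite mulrCA.
by rewrite eq_sym => /negPf ne; rewrite !mxE ne !mul0r.
Qed.

Definition R : CF3 := cfRepr (MxRepresentation refl_mx_repr).

Definition degree2_index : Iirr [set: 'S_3] :=
  odflt 0 [pick i | 'chi[[set: 'S_3]]_i 1%g == 2%:R].

Lemma degree2_unique (i : Iirr [set: 'S_3]) :
  ('chi_i 1%g == 2%:R) = (i == degree2_index).
Proof.
pose n (k : Iirr [set: 'S_3]) := irr_degree (socle_of_Iirr k).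
have nE k : 'chi_k 1%g = (n k)%:R by rewrite irr1_degree.
have n_gt0 k : (0 < n k)%N by apply: irr_degree_gt0.
have sum6 : (\sum_k n k ^ 2 = 6)%N.
  apply/eqP; rewrite -(eqr_nat algC) natr_sum.
  have <- : #|[set: 'S_3]| = 6%N by rewrite cardsT card_Sn.
  rewrite -irr_sum_square; apply/eqP/eq_bigr => k _.
  by rewrite nE natrX.
have n0 : n 0 = 1%N.
  by apply/eqP; rewrite -(eqr_nat algC) -nE irr0 cfun11.
have nabel : ~~ abelian [set: 'S_3].
  apply/negP=> /centsP cSS.
  have /permP/(_ (coord 0)) := cSS (tperm (coord 0) (coord 1)) (in_setT _)
    (tperm (coord 1) (coord 2)) (in_setT _).
  rewrite !permM !tpermL (tpermD (x := coord 1)) -?val_eqE /= ?inordK //.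
  by rewrite tpermL => /(congr1 val); rewrite /= !inordK.
have [k n_k] : exists k, n k = 2.
  have: ~~ [forall k : Iirr [set: 'S_3], 'chi_k \is a linear_char].
    by apply: contra nabel => /forallP/char_abelianP.
  case/forallPn=> k; rewrite qualifE/= irr_char nE pnatr_eq1 /= => nk1.
  exists k; have k0 : k != 0 by apply: contraNneq nk1 => ->; rewrite n0.
  have := n_gt0 k; move: sum6; rewrite (bigD1 k) // (bigD1 0) 1?eq_sym //= n0.
  by case: (n k) nk1 => [|[|[|m]]] // _; rewrite -mulnn mulSn; lia.
have uniq2 j : n j = 2 -> j = k.
  move=> n_j; apply/eqP; apply: contraT => jk; move: sum6.
  by rewrite (bigD1 k) // (bigD1 j) //= n_j n_k addnA; lia.
have n2 j : ('chi_j 1%g == 2%:R) = (j == k).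
  rewrite nE eqr_nat; apply/eqP/eqP => [/uniq2 | ->] //.
suff -> : degree2_index = k by apply: n2.
rewrite /degree2_index; case: pickP => [j | /(_ k)]; rewrite n2 ?eqxx //.
by move/eqP.
Qed.

(* The projection from B3 onto S_3 is surjective; the restriction only        *)
(* matches types.                                                             *)
Definition U : CF3 :=
  cfMorph ('Res[(sproj @* B3)%g] 'chi[[set: 'S_3]]_degree2_index).

Definition charA (tau : CF3) : CF3 := tau * (1 + U).
Definition charB (tau : CF3) : CF3 := tau * (1 + U + R).
Definition charE (tau : CF3) : CF3 := tau * (1 + U + R + eps * R + delta * R).
Definition charF (tau : CF3) : CF3 := tau * (1 + eps * R).
Definition charC : CF3 := 1 + eps + R + eps * R.
Definition charD : CF3 := 1 + eps + U + eps * U + R + eps * R.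
Definition charLp : CF3 := 1 + omega.
Definition charLm : CF3 := delta + eps.

Definition omega_twist (F : seq CF3) : seq CF3 := [seq omega * phi | phi <- F].

Definition perfect_families : seq (seq CF3) :=
  [:: [:: charC; delta * charD];
      [:: charC; charB delta; charB omega];
      [:: charB eps; charE delta; 1; omega];
      [:: charE omega; charB 1; delta; eps]].

Definition N_families : seq (seq CF3) :=
  [:: [:: charF 1; charF eps; charB delta; charB omega];
      [:: charF 1; charF eps; delta * charD];
      [:: charF 1; charE delta; charA eps; omega];
      [:: charF 1; charE delta; charA omega; eps];
      [:: charB eps; charE delta; charLp];
      [:: charE omega; charF eps; charA 1; delta];
      [:: charE omega; charF eps; charA delta; 1];
      [:: charE omega; charB 1; charLm]].

Definition with_twists (Fs : seq (seq CF3)) : seq (seq CF3) :=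
  Fs ++ [seq omega_twist F | F <- Fs].

(* Main.v *)
From HB Require Import structures.
Require Import Defs.
From mathcomp Require Import all_boot all_order all_fingroup all_algebra.
From mathcomp Require Import all_solvable all_field all_character.
From mathcomp Require Import zify ring.

(* Every linear character of a standard parabolic subgroup W_J of W = B3 is  *)
(* the restriction of one of 1, delta, eps, omega, so an allowed character is *)
(* tau * Ind_H^W 1 with H <= W_J quasiparabolic.  The terms of a Gelfand      *)
(* model are multiplicity-free, hence are subsets of the ten irreducible      *)
(* characters, and a model is a partition of this ten-element set into such   *)
(* subsets.  The group has only 98 subgroups; those H for which Ind_H^W 1 is  *)
(* multiplicity-free and which are quasiparabolic give, with twists by tau,   *)
(* 40 subsets; these partition the irreducible characters in exactly 24 ways. *)

(** Why this reduces to a computation. In a model each irreducible character has total multiplicity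
    1, and multiplicities are natural numbers, so each term has multiplicities 0 or 1 and is
    determined by its mask, the set of members of [irr10] that it contains ([cf_maskK]). Models thus
    become exact covers of a ten-element set ([sum_mask_cf]). By [irr10_complete] the ten characters
    are all the irreducible ones; all are integer-valued, so Frobenius reciprocity turns the
    multiplicities of an induced character into integer sums over the subgroup H ([cfdot_induced]),
    and [lin_restrict] leaves four choices of sigma.

    For the upper bound, signed permutations are coded by finite data and quasiparabolicity becomes
    the boolean test [qp_codes] ([qp_codesP]). One run of [search] for each J covers every subgroup
    of W_J ([search_subgroup]); [allowed_mask] then confines the masks to a list, and [coversP]
    shows that the exact covers by members of that list are all among the 24 in [model_masks].

    Conversely, explicit subgroups realize every term of these 24 ([allowed_certP]). The perfect
    realizations use only two kinds of involution inside W_J ([perfect_certP]): the identity, whose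
    centralizer is W_J, and s_1 in the group generated by s_0 and s_1. *)

Set Implicit Arguments.
Unset Strict Implicit.
Unset Printing Implicit Defensive.

Import GroupScope Order.TTheory GRing.Theory Num.Theory.
Local Open Scope ring_scope.

(** * Encoding of signed permutations *)

(* [Pabc] maps 0, 1, 2 to a, b, c. *)
Inductive sym3 := P012 | P021 | P102 | P120 | P201 | P210.

Definition sym3_eqb (p q : sym3) : bool :=
  match p, q with
  | P012, P012 | P021, P021 | P102, P102 | P120, P120 | P201, P201
  | P210, P210 => true
  | _, _ => false
  end.

Lemma sym3_eqP : Equality.axiom sym3_eqb.
Proof. by do 2!case; constructor. Qed.

HB.instance Definition _ := hasDecEq.Build sym3 sym3_eqP.

Definition sym3_app (p : sym3) (i : nat) : nat :=
  match p, i with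
  | P012, 0 => 0 | P012, 1 => 1 | P012, _ => 2
  | P021, 0 => 0 | P021, 1 => 2 | P021, _ => 1
  | P102, 0 => 1 | P102, 1 => 0 | P102, _ => 2
  | P120, 0 => 1 | P120, 1 => 2 | P120, _ => 0
  | P201, 0 => 2 | P201, 1 => 0 | P201, _ => 1
  | P210, 0 => 2 | P210, 1 => 1 | P210, _ => 0
  end%N.

Definition sym3_of (i j : nat) : sym3 :=
  match i, j with
  | 0, 1 => P012 | 0, _ => P021 | 1, 0 => P102 | 1, _ => P120
  | _, 0 => P201 | _, _ => P210
  end%N.

(* [(b0, b1, b2, p)] sends coordinate i to coordinate p(i), negated if b_i. *)
Definition code : Type := (bool * bool * bool * sym3)%type.

Definition code_neg (c : code) (i : nat) : bool :=
  let: (b0, b1, b2, _) := c in match i with 0 => b0 | 1 => b1 | _ => b2 end%N.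

Definition code_mul (c d : code) : code :=
  let: (b0, b1, b2, p) := c in let: (_, _, _, q) := d in
  (b0 (+) code_neg d (sym3_app p 0), b1 (+) code_neg d (sym3_app p 1),
   b2 (+) code_neg d (sym3_app p 2),
   sym3_of (sym3_app q (sym3_app p 0)) (sym3_app q (sym3_app p 1))).

(** Nested conditionals, here and in [code_mem] and [search], let [vm_compute] stop early: under
    call by value the boolean connectives evaluate both arguments. *)
Definition code_eqb (c d : code) : bool :=
  let: (b0, b1, b2, p) := c in let: (e0, e1, e2, q) := d in
  if sym3_eqb p q then
    if b0 (+) e0 then false else if b1 (+) e1 then false else ~~ (b2 (+) e2)
  else false.

Lemma code_eqbE c d : code_eqb c d = (c == d).
Proof.
by case: c d => [[[[] []] []] []] [[[[] []] []] []].
Qed.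

Fixpoint code_mem (c : code) (K : seq code) : bool :=
  if K is d :: K' then if code_eqb c d then true else code_mem c K' else false.

Lemma code_memE c K : code_mem c K = (c \in K).
Proof. by elim: K => //= d K ->; rewrite inE code_eqbE; case: eqP. Qed.

Definition code1 : code := (false, false, false, P012).
Definition code_s0 : code := (true, false, false, P012).
Definition code_s1 : code := (false, false, false, P102).
Definition code_s2 : code := (false, false, false, P021).

Definition codes : seq code :=
  let bools := [:: false; true] in
  [seq (b, p) | b <- [seq (b, b2) | b <- [seq (b0, b1) | b0 <- bools,
     b1 <- bools], b2 <- bools],
     p <- [:: P012; P021; P102; P120; P201; P210]].

Lemma mem_codes c : c \in codes.
Proof. by case: c => [[[[] []] []] []]. Qed.

Lemma codes_uniq : uniq codes.
Proof. by vm_compute. Qed.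

Lemma all_codes (P : pred code) : all P codes -> forall c, P c.
Proof. by move/allP=> PP c; rewrite PP ?mem_codes. Qed.

Lemma sym3_appS p (i : 'I_3) : (sym3_app p i < 3)%N.
Proof. by case: p; case: i => [[|[|[|?]]]]. Qed.

Definition decode_fun (c : code) (x : spoint) : spoint :=
  (x.1 (+) code_neg c x.2, Ordinal (sym3_appS c.2 x.2)).

Lemma decode_fun_inj c : injective (decode_fun c).
Proof.
move=> [b i] [b' j] [/= eb ei].
have ij : i = j.
  apply/val_inj; move: ei; case: c {eb} => [_ []] /=;
  by case: i j => [[|[|[|?]]] ?] [[|[|[|?]]] ?].
by move: eb; rewrite ij => /addIb->.
Qed.

Definition decode (c : code) : {perm spoint} := perm (@decode_fun_inj c).

Lemma decodeE c b i :
  decode c (b, i) = (b (+) code_neg c i, Ordinal (sym3_appS c.2 i)).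
Proof. by rewrite permE. Qed.

Lemma decodeM c d : decode (code_mul c d) = (decode c * decode d)%g.
Proof.
apply/permP=> -[b i]; rewrite permM !decodeE.
case: c d => [[[b0 b1] b2] p] [[[e0 e1] e2] q].
congr pair; last by apply/val_inj; case: p q i => [] [] [[|[|[|?]]]].
rewrite /= -addbA; congr addb.
by case: p i => [] [[|[|[|?]]]].
Qed.

Lemma decode1 : decode code1 = 1%g.
Proof.
apply/permP=> -[b i]; rewrite decodeE perm1; congr pair.
  by case: i => [[|[|[|?]]] ?]; rewrite /= addbF.
by apply/val_inj; case: i => [[|[|[|?]]]].
Qed.

Lemma decode_B3 c : decode c \in B3.
Proof. by apply/B3P=> b i; rewrite !decodeE /spoint_opp /= addNb. Qed.

Definition o0 : 'I_3 := @Ordinal 3 0 isT.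
Definition o1 : 'I_3 := @Ordinal 3 1 isT.
Definition o2 : 'I_3 := @Ordinal 3 2 isT.

Lemma coordE :
  (Defs.coord 0 = o0) * (Defs.coord 1 = o1) * (Defs.coord 2 = o2).
Proof. by do 2?split; apply/val_inj; rewrite /= inordK. Qed.

Definition encode (w : {perm spoint}) : code :=
  (neg w o0, neg w o1, neg w o2, sym3_of (sproj_fun w o0) (sproj_fun w o1)).

Lemma neg_decode c i : neg (decode c) i = code_neg c i.
Proof. by rewrite /neg decodeE. Qed.

Lemma sproj_fun_decode c i : sproj_fun (decode c) i = Ordinal (sym3_appS c.2 i).
Proof. by rewrite /sproj_fun decodeE. Qed.

Lemma decodeK : cancel decode encode.
Proof.
move=> c; rewrite /encode !neg_decode !sproj_fun_decode.
by case: c => [[[? ?] ?] []].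
Qed.

Lemma decode_inj : injective decode. Proof. exact: can_inj decodeK. Qed.

(** [encode] records the images of two coordinates only; injectivity of the underlying permutation
    forces the third. *)
Lemma encodeK w : w \in B3 -> decode (encode w) = w.
Proof.
move=> Ww; apply/permP=> -[b i]; rewrite decodeE (B3E _ _ Ww); congr pair.
  by congr addb; case: i => [[|[|[|?]]] lti] //=; congr neg; apply/val_inj.
have inj := sproj_inj Ww; apply/val_inj.
have [] : [/\ sproj_fun w o0 != sproj_fun w o1, sproj_fun w o0 != sproj_fun w o2
        & sproj_fun w o1 != sproj_fun w o2].
  by split; rewrite (inj_eq inj).
rewrite /=.
have -> : sproj_fun w i =
    nth o0 [:: sproj_fun w o0; sproj_fun w o1; sproj_fun w o2] i.
  by case: i => [[|[|[|?]]] ?] //=; congr sproj_fun; apply/val_inj.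
rewrite -!val_eqE /=.
case: i (sproj_fun w o0) (sproj_fun w o1) (sproj_fun w o2).
by case=> [|[|[|//]]] ?; case=> [[|[|[|//]]]] ?; case=> [[|[|[|//]]]] ?;
  case=> [[|[|[|//]]]].
Qed.

(** * Lengths, coset heights and quasiparabolicity *)

Section Tabulate.
Variable A : Type.
Implicit Types (f : code -> A).

Definition tab_bool B (f : bool -> B) : bool -> B :=
  let x := f false in let y := f true in fun b => if b then y else x.

Definition tab_sym3 (f : sym3 -> A) : sym3 -> A :=
  let x0 := f P012 in let x1 := f P021 in let x2 := f P102 in
  let x3 := f P120 in let x4 := f P201 in let x5 := f P210 in
  fun p => match p with P012 => x0 | P021 => x1 | P102 => x2 | P120 => x3
    | P201 => x4 | P210 => x5 end.

(* Extensionally the identity, but each value is computed only once. *)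
Definition tabulate f : code -> A :=
  let g := tab_bool (fun b0 => tab_bool (fun b1 => tab_bool (fun b2 =>
    tab_sym3 (fun p => f (b0, b1, b2, p))))) in
  fun c => let: (b0, b1, b2, p) := c in g b0 b1 b2 p.

Lemma tabulateE f : tabulate f =1 f.
Proof. by case=> [[[[] []] []] []]. Qed.

End Tabulate.

Definition dset (K : seq code) : {set {perm spoint}} := [set w in map decode K].

Lemma mem_dset K c : (decode c \in dset K) = (c \in K).
Proof. by rewrite inE mem_map //; apply: decode_inj. Qed.

Lemma dsetP K w : reflect (exists2 c, c \in K & w = decode c) (w \in dset K).
Proof. by rewrite inE; apply: mapP. Qed.

Lemma dset_codes : dset codes = B3.
Proof.
apply/setP=> w; apply/dsetP/idP => [[c _ ->]|Ww]; first exact: decode_B3.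
by exists (encode w); rewrite ?mem_codes ?encodeK.
Qed.

Lemma enum_dset K (A : {set {perm spoint}}) : uniq K -> A =i dset K ->
  perm_eq (enum A) (map decode K).
Proof.
move=> uK AK; apply: uniq_perm; rewrite ?enum_uniq ?map_inj_uniq //.
  exact: decode_inj.
by move=> w; rewrite mem_enum AK inE.
Qed.

Lemma big_dset (I : Type) (idx : I) (op : Monoid.com_law idx) K
    (A : {set {perm spoint}}) (F : {perm spoint} -> I) :
  uniq K -> A =i dset K ->
  \big[op/idx]_(w in A) F w = \big[op/idx]_(c <- K) F (decode c).
Proof.
by move=> uK AK; rewrite -big_enum (perm_big _ (enum_dset uK AK)) big_map.
Qed.

Lemma card_dset K (A : {set {perm spoint}}) :
  uniq K -> A =i dset K -> #|A| = size K.
Proof.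
by move=> uK AK; rewrite cardE (perm_size (enum_dset uK AK)) size_map.
Qed.

Definition group_codes (K : seq code) : bool :=
  (code1 \in K) && all (fun c => all (fun d => code_mem (code_mul c d) K) K) K.

Lemma group_codesP K : group_codes K -> group_set (dset K).
Proof.
case/andP=> K1 /allP KM; apply/group_setP; split.
  by rewrite -decode1 mem_dset.
move=> _ _ /dsetP[c Kc ->] /dsetP[d Kd ->]; rewrite -decodeM mem_dset -code_memE.
exact: (allP (KM c Kc)).
Qed.

Definition next_level (J L : seq code) : seq code :=
  [seq c <- codes | has (fun s => code_mem (code_mul s c) L) J].

Fixpoint levels (J : seq code) (n : nat) (L : seq code) : seq (seq code) :=
  if n is m.+1 then L :: levels J m (next_level J L) else [::].

(* 10 exceeds all lengths, the longest element of B3 having length 9. *)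
Definition code_length (J : seq code) : code -> nat :=
  let lv := levels J 10 [:: code1] in tabulate (fun c => find (code_mem c) lv).

Definition parabolic (J : seq code) : seq code :=
  let l := code_length J in [seq c <- codes | (l c < 10)%N].

Definition code_reflections (J E : seq code) : seq code :=
  [seq r <- E | has (fun s => has (fun w =>
     code_eqb (code_mul w r) (code_mul s w)) E) J].

(** The computable facts about J from which [parabolic J] is shown to be the whole group generated
    by J. *)
Definition simple_subset (J : seq code) : bool :=
  [&& all (fun s => code_mul s s == code1) J, all [in parabolic J] J
    & group_codes (parabolic J)].

Lemma simple_dset (J : seq code) : simple_subset J ->
  {in dset J, forall s, s * s = 1}%g.
Proof.
case/and3P=> /allP JJ _ _ _ /dsetP[c Jc ->].
by rewrite -decodeM (eqP (JJ c Jc)) decode1.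
Qed.

Section Lengths.
Variable J : seq code.
Hypothesis sJ : simple_subset J.

(** Generators are involutions, so c is s times an element of L exactly when s times c lies in L,
    which is what [next_level] tests. *)
Lemma mem_iter_level n c :
  (c \in iter n (next_level J) [:: code1]) = (decode c \in dset J ^+ n)%g.
Proof.
elim: n c => [|n IHn] c /=.
  by rewrite !inE -decode1 (inj_eq decode_inj).
rewrite expgS mem_filter mem_codes andbT; apply/hasP/mulsgP.
  case=> s Js; rewrite code_memE IHn decodeM => sc.
  exists (decode s) (decode s * decode c)%g; rewrite ?mem_dset // mulgA.
  by rewrite (simple_dset sJ) ?mul1g // mem_dset.
case=> _ t /dsetP[s Js ->] Jt ct; exists s => //.
by rewrite code_memE IHn decodeM ct mulgA (simple_dset sJ) ?mul1g // mem_dset.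
Qed.

Lemma code_lengthE c :
  code_length J c = find (fun n => decode c \in dset J ^+ n)%g (iota 0 10).
Proof.
rewrite /code_length tabulateE.
have -> : levels J 10 [:: code1] =
    [seq iter n (next_level J) [:: code1] | n <- iota 0 10] by [].
rewrite find_map; apply: eq_find => n /=.
by rewrite code_memE mem_iter_level.
Qed.

(** The order of the ambient group is the search bound in [cox_length] and the default in
    [coset_height]; it therefore exceeds the cutoffs 10 and 9 of the coded versions. *)
Lemma card_perm_spoint : (48 <= #|{perm spoint}|)%N.
Proof.
by apply: leq_trans (max_card [in B3]); rewrite -dset_codes (card_dset codes_uniq).
Qed.

Lemma cox_lengthE c : (code_length J c < 10)%N ->
  cox_length (dset J) (decode c) = code_length J c.
Proof.
rewrite code_lengthE => lt10; rewrite /cox_length.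
have := card_perm_spoint; move: #|_| => N leN.
have -> : N = (10 + (N - 10))%N by lia.
rewrite iotaD find_cat has_find size_iota.
by rewrite lt10.
Qed.

(** An element with a length is a product of generators; conversely the list has been checked to be
    a group containing J. *)
Lemma dset_parabolic : dset (parabolic J) = <<dset J>>%g.
Proof.
have [_ /allP sub grp] := and3P sJ.
apply/eqP; rewrite eqEsubset; apply/andP; split; last first.
  rewrite -[dset (parabolic J)]/(gval (Group (group_codesP grp))) gen_subG.
  by apply/subsetP=> _ /dsetP[c Jc ->]; rewrite mem_dset sub.
apply/subsetP=> _ /dsetP[c + ->]; rewrite mem_filter code_lengthE.
rewrite -[X in (_ < X)%N](size_iota 0 10) -has_find => /andP[/hasP[n _ +] _].
elim: n (decode c) => [|n IHn] w; first by rewrite inE => /eqP->.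
by rewrite expgS => /mulsgP[s t Js /IHn Gt ->]; rewrite groupM // mem_gen.
Qed.

Lemma mem_parabolic c : (decode c \in <<dset J>>%g) = (c \in parabolic J).
Proof. by rewrite -dset_parabolic mem_dset. Qed.

Lemma parabolicM c d : c \in parabolic J -> d \in parabolic J ->
  code_mul c d \in parabolic J.
Proof. by rewrite -!mem_parabolic decodeM; apply: groupM. Qed.

Lemma sub_parabolic s : s \in J -> s \in parabolic J.
Proof. by move=> Js; rewrite -mem_parabolic mem_gen ?mem_dset. Qed.

Lemma parabolic_length c : c \in parabolic J -> (code_length J c < 10)%N.
Proof. by rewrite mem_filter => /andP[]. Qed.

Lemma mem_code_reflections r : (r \in code_reflections J (parabolic J)) =
  (decode r \in reflections (dset J)).
Proof.
rewrite mem_filter; apply/andP/imset2P.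
  case=> /hasP[s Js /hasP[w Ew]]; rewrite code_eqbE => /eqP wr Er.
  exists (decode s) (decode w); rewrite ?mem_dset ?mem_parabolic //.
  by rewrite conjgE -decodeM -wr decodeM mulKg.
case=> _ w /dsetP[s Js ->]; rewrite -dset_parabolic => /dsetP[d Ed ->] rsd.
split.
  apply/hasP; exists s => //; apply/hasP; exists d => //.
  rewrite code_eqbE -(inj_eq decode_inj) !decodeM rsd conjgE.
  by rewrite !mulgA mulgV mul1g.
by rewrite -mem_parabolic rsd groupJ ?mem_parabolic // sub_parabolic.
Qed.

Lemma reflections_sub r : r \in reflections (dset J) ->
  exists2 c, r = decode c & c \in parabolic J.
Proof.
move=> Tr; have /dsetP[c Ec rc] : r \in dset (parabolic J).
  rewrite dset_parabolic; case/imset2P: Tr => s w Js Ww ->.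
  by rewrite groupJ // mem_gen.
by exists c.
Qed.

End Lengths.

(** Lengths in a parabolic subgroup are at most 9, so starting from 9 gives the true minimum over
    the coset. *)
Definition code_height (l : code -> nat) (K : seq code) : code -> nat :=
  tabulate (fun c => foldr (fun k m => minn (l (code_mul c k)) m) 9%N K).

Definition same_coset (K : seq code) (c d : code) : bool :=
  has (fun k => code_eqb (code_mul c k) d) K.

(** The axioms are tested on all elements of W_J as representatives of cosets, with equality of
    cosets replaced by [same_coset]. *)
Definition qp_codes (J K : seq code) : bool :=
  let E := parabolic J in
  let T := code_reflections J E in
  let h := code_height (code_length J) K in
  all (fun c =>
    let hc := h c in
    all (fun s => let hsc := h (code_mul s c) in
      (hsc <= hc.+1) && (hc <= hsc.+1))%N J &&
    all (fun r =>
      let rc := code_mul r c in let hrc := h rc in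
      ((hrc == hc) ==> same_coset K c rc) &&
      ((hc < hrc)%N ==>
        all (fun s => let sc := code_mul s c in
          (h (code_mul s rc) < h sc)%N ==> same_coset K rc sc) J)) T) E.

Section BigMin.
Variables (T : eqType) (f : T -> nat).
Implicit Types (s : seq T) (m n : nat).

Lemma bigminn_le n s x : x \in s -> (\big[minn/n]_(y <- s) f y <= f x)%N.
Proof.
elim: s => // y s IHs; rewrite inE big_cons geq_min => /predU1P[->|/IHs->].
  by rewrite leqnn.
by rewrite orbT.
Qed.

Lemma le_bigminn n s m : (m <= n)%N -> (forall x, x \in s -> m <= f x)%N ->
  (m <= \big[minn/n]_(y <- s) f y)%N.
Proof.
move=> mn mf; rewrite big_seq; elim/big_ind: _ => // x y mx my.
by rewrite leq_min mx.
Qed.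

(** Bridges the two defaults, 9 and the order of the ambient group: one value below both makes the
    minima agree. *)
Lemma eq_bigminn n1 n2 s1 s2 x : s1 =i s2 -> x \in s1 -> (f x <= n1)%N ->
  (f x <= n2)%N -> \big[minn/n1]_(y <- s1) f y = \big[minn/n2]_(y <- s2) f y.
Proof.
move=> s12 s1x fx1 fx2; apply/eqP; rewrite eqn_leq; apply/andP; split.
  apply: le_bigminn => [|y]; first exact: leq_trans (bigminn_le _ s1x) fx2.
  by rewrite -s12; apply: bigminn_le.
apply: le_bigminn => [|y]; last by rewrite s12; apply: bigminn_le.
by rewrite s12 in s1x; apply: leq_trans (bigminn_le _ s1x) fx1.
Qed.

End BigMin.

Section QuasiparabolicCodes.
Variables (J K : seq code) (H : {group {perm spoint}}).
Hypotheses (sJ : simple_subset J) (uK : uniq K) (HK : gval H =i dset K).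
Hypothesis sHJ : H \subset <<dset J>>.

Lemma codes_sub c : c \in K -> c \in parabolic J.
Proof. by move=> Kc; rewrite -mem_parabolic // (subsetP sHJ) // HK mem_dset. Qed.

Lemma same_cosetP c d :
  reflect (decode c *: H = decode d *: H)%g (same_coset K c d).
Proof.
suff -> : same_coset K c d = (decode d \in decode c *: H)%g.
  by apply: (iffP lcoset_eqP) => ->.
rewrite mem_lcoset HK; apply/hasP/dsetP => -[k Kk].
  by rewrite code_eqbE => /eqP <-; exists k => //; rewrite decodeM mulKg.
move=> dck; exists k => //; rewrite code_eqbE -(inj_eq decode_inj) decodeM -dck.
by rewrite mulKVg.
Qed.

Lemma code_heightE c : c \in parabolic J ->
  coset_height (dset J) (decode c *: H)%g = (code_height (code_length J) K c)%:Z.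
Proof.
move=> Ec; rewrite /coset_height /code_height tabulateE; congr Posz.
have lt10 k : k \in K -> (code_length J (code_mul c k) < 10)%N.
  by move=> Kk; apply: parabolic_length; apply: parabolicM => //; apply: codes_sub.
have -> : foldr (fun k m => minn (code_length J (code_mul c k)) m) 9 K =
    \big[minn/9]_(k <- K) code_length J (code_mul c k).
  by rewrite unlock.
have -> : \big[minn/9]_(k <- K) code_length J (code_mul c k) =
    \big[minn/9]_(u <- map decode (map (code_mul c) K)) cox_length (dset J) u.
  rewrite !big_map big_seq [RHS]big_seq; apply: eq_bigr => k Kk.
  by rewrite cox_lengthE ?lt10.
have K1 : code1 \in K by rewrite -mem_dset -HK decode1 group1.
rewrite -big_filter; apply: (@eq_bigminn _ _ _ _ _ _ (decode c)).
- move=> u; rewrite mem_filter mem_index_enum andbT mem_lcoset HK -map_comp.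
  apply/dsetP/mapP => -[k Kk].
    by move=> uk; exists k => //=; rewrite decodeM -uk mulKVg.
  by move=> /= ->; exists k => //; rewrite decodeM mulKg.
- by rewrite mem_filter mem_index_enum andbT lcoset_refl.
- rewrite cox_lengthE ?parabolic_length //.
  apply: leq_trans card_perm_spoint; apply: ltnW.
  exact: leq_trans (parabolic_length Ec) _.
- by rewrite cox_lengthE ?parabolic_length //; have := parabolic_length Ec; lia.
Qed.

Lemma qp_codesP : reflect (quasiparabolic_subgroup (dset J) H) (qp_codes J K).
Proof.
pose h := code_height (code_length J) K.
have hE c : c \in parabolic J ->
    coset_height (dset J) (decode c *: H)%g = (h c)%:Z.
  exact: code_heightE.
have parM s c : (decode s *: (decode c *: H) = decode (code_mul s c) *: H)%g.
  by rewrite -lcosetM decodeM.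
apply: (iffP idP) => [/allP qpK | [_ qpH]].
  split=> //; split; first split.
  - move=> w x Ww /lcosetsP[v Wv ->]; apply/lcosetsP.
    by exists (w * v)%g; rewrite ?groupM // lcosetM.
  - by move=> x _; rewrite lcoset1.
  - by move=> v w x _ _ _; rewrite lcosetM.
  - move=> _ x /dsetP[s Js ->] /lcosetsP[v]; rewrite -dset_parabolic //.
    case/dsetP=> c Ec -> ->; have Es := sub_parabolic sJ Js.
    rewrite parM ?hE ?parabolicM //.
    have /andP[/allP/(_ s Js)/andP[]] := qpK c Ec.
    by rewrite -/h; lia.
  - move=> x r /lcosetsP[v]; rewrite -dset_parabolic // => /dsetP[c Ec ->] ->.
    move=> Tr; have [d rd Ed] := reflections_sub sJ Tr.
    rewrite {}rd -mem_code_reflections // in Tr *.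
    rewrite parM ?hE ?parabolicM // => -[hh].
    have /andP[_ /allP/(_ d Tr)/andP[/implyP]] := qpK c Ec.
    by rewrite -/h hh eqxx => /(_ isT)/same_cosetP->.
  move=> x r s0 /lcosetsP[v]; rewrite -dset_parabolic // => /dsetP[c Ec ->] ->.
  move=> Tr; have [d rd Ed] := reflections_sub sJ Tr.
  rewrite {}rd -mem_code_reflections // in Tr *.
  case/dsetP=> s Js ->; have Es := sub_parabolic sJ Js.
  rewrite !parM ?hE ?parabolicM // !ltz_nat => h1 h2.
  have /andP[_ /allP/(_ d Tr)/andP[_ /implyP]] := qpK c Ec.
  by rewrite -/h h1 => /(_ isT)/allP/(_ s Js)/implyP/(_ h2)/same_cosetP->.
have [_ q1 q2] := qpH; apply/allP=> c Ec; rewrite /= -/h.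
have Xc : (decode c *: H)%g \in lcosets H <<dset J>>.
  by apply/lcosetsP; exists (decode c); rewrite ?mem_parabolic.
apply/andP; split; apply/allP=> r Jr.
  have Er := sub_parabolic sJ Jr.
  have Jdr : decode r \in dset J by rewrite mem_dset.
  have := scaled_height (qp_scaled qpH) Jdr Xc.
  by rewrite parM // !hE ?parabolicM //; lia.
have Er : r \in parabolic J by move: Jr; rewrite mem_filter => /andP[].
rewrite mem_code_reflections // in Jr.
have := q1 _ _ Xc Jr; have := fun s => q2 _ _ s Xc Jr.
rewrite !parM ?hE ?parabolicM // => q2' q1'.
apply/andP; split.
  by apply/implyP=> /eqP hh; apply/same_cosetP/esym/q1'; rewrite hh.
apply/implyP=> h1; apply/allP=> s Js; apply/implyP=> h2; apply/same_cosetP.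
have Es := sub_parabolic sJ Js.
have Jds : decode s \in dset J by rewrite mem_dset.
by have := q2' _ Jds; rewrite !parM ?hE ?parabolicM // !ltz_nat; apply.
Qed.

End QuasiparabolicCodes.

(** * Subgroup search *)

(* Left multiplication by [gens] enlarges the union [L] of left cosets of the *)
(* group [K]; [queue] lists the coset representatives still to be multiplied. *)
Fixpoint coset_closure (fuel : nat) (gens K queue L : seq code) : seq code :=
  match fuel, queue with
  | n.+1, r :: q =>
    let: (q', L') := foldl (fun (s : seq code * seq code) g =>
        let: (q, L) := s in let x := code_mul g r in
        if code_mem x L then (q, L) else (rcons q x, L ++ map (code_mul x) K))
      (q, L) gens
    in coset_closure n gens K q' L'
  | _, _ => L
  end.

(** Entries of the queue represent distinct left cosets of K, of which there are at most 48, whence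
    the fuel. *)
Definition adjoin (gens K : seq code) (x : code) : seq code :=
  coset_closure 48 (x :: gens) K [:: code1] K.

(* Decides for each element of [todo] in turn whether it belongs to the       *)
(* subgroup: [out] lists the excluded elements, and [gens] generates the      *)
(* group [K] of those known to belong to it.                                  *)
Fixpoint search (P : pred (seq code)) (out gens K todo : seq code) : bool :=
  match todo with
  | [::] => P K
  | x :: t =>
    if code_mem x K then search P out gens K t else
    if search P (x :: out) gens K t then
      let K' := adjoin gens K x in
      if has (fun y => code_mem y out) K' then true else
      if all (fun y => code_mem y K') (x :: K)
      then search P out (x :: gens) K' t else false
    else false
  end.

Lemma all_coset_closure (P : pred code) fuel gens K queue L :
    (forall c d, P c -> P d -> P (code_mul c d)) ->
  all P gens -> all P K -> all P queue -> all P L ->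
  all P (coset_closure fuel gens K queue L).
Proof.
move=> PM Pgens PK; elim: fuel queue L => [|n IHn] [|r q] L //= /andP[Pr Pq] PL.
case E: (foldl _ _ _) => [q' L'].
suff /andP[Pq' PL'] : all P q' && all P L' by apply: IHn.
elim: gens q L q' L' Pgens Pq PL E {IHn} => [|g gs IHg] q L q' L' /=.
  by move=> _ Pq PL [<- <-]; rewrite Pq.
case/andP=> Pg Pgs Pq PL; case: ifP => _; first exact: IHg.
apply: IHg; rewrite ?all_rcons ?all_cat ?PL ?Pq ?PM //= all_map.
by apply: sub_all PK => c /= Pc; rewrite !PM.
Qed.

Lemma searchP (P : pred (seq code)) out gens K todo (H : {group {perm spoint}}) :
    search P out gens K todo ->
    all [pred c | decode c \in H] gens -> all [pred c | decode c \in H] K ->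
    all [pred c | decode c \notin H] out ->
  exists L, [/\ P L, all [pred c | decode c \in H] L &
    forall c, decode c \in H -> c \in K ++ todo -> c \in L].
Proof.
elim: todo out gens K => [|x t IHt] out gens K /=.
  by move=> PK _ HK _; exists K; split=> // c _; rewrite cats0.
have lift K' L : {subset x :: K <= K'} ->
    (forall c, decode c \in H -> c \in K' ++ t -> c \in L) ->
    (forall c, decode c \in H -> c \in K ++ x :: t -> c \in L).
  move=> sKK' sL c Hc; rewrite mem_cat inE orbA => Kxtc; apply: sL => //.
  rewrite mem_cat; case/orP: Kxtc => [Kxc|->]; last exact: orbT.
  by rewrite sKK' // inE orbC.
rewrite code_memE; case: ifP => [Kx s Hgens HK Hout | _].
  have [L [PL HL sL]] := IHt _ _ _ s Hgens HK Hout; exists L; split=> //.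
  by apply: lift sL => c /predU1P[->|].
case: ifP => // sx + Hgens HK Hout.
have [Hx | Hx] := boolP (decode x \in H); last first.
  move=> _; have [|L [PL HL sL]] := IHt _ _ _ sx Hgens HK; first by rewrite /= Hx.
  exists L; split=> // c Hc; rewrite mem_cat inE => /or3P[Kc|/eqP cx|tc].
  - by apply: sL; rewrite // mem_cat Kc.
  - by rewrite -cx Hc in Hx.
  - by apply: sL; rewrite // mem_cat tc orbT.
have HK' : all [pred c | decode c \in H] (adjoin gens K x).
  apply: all_coset_closure; rewrite //= ?Hx ?decode1 ?group1 //.
  by move=> c d /= Hc Hd; rewrite decodeM groupM.
move: (adjoin gens K x) HK' => K' HK'.
(* The closure lies in H while the excluded elements do not, so pruning never cuts off the branch of
   H. *)
have -> : has (fun y => code_mem y out) K' = false.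
  apply/hasP=> -[y K'y]; rewrite code_memE => /(allP Hout) /=.
  by have /= -> := allP HK' y K'y.
case: ifP => // sKK' s.
have [|L [PL HL sL]] := IHt _ _ _ s _ HK' Hout; first by rewrite /= Hx.
exists L; split=> //; apply: lift sL => c xKc.
rewrite -code_memE; case/andP: sKK' => xK' /allP KK'.
by case/predU1P: xKc => [->|/KK'].
Qed.

Lemma search_subgroup (P : pred (seq code)) J (H : {group {perm spoint}}) :
    simple_subset J -> H \subset <<dset J>>%g ->
    search P [::] [::] [:: code1] (parabolic J) ->
  exists2 K, P K & gval H =i dset K.
Proof.
move=> sJ sHJ s.
have [|//|//|L [PL HL sL]] := searchP (H := H) s; first by [].
  by rewrite /= decode1 group1.
exists L => // w; apply/idP/dsetP => [Hw | [c Lc ->]]; last exact: (allP HL).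
have /dsetP[c Ec wc] : w \in dset (parabolic J).
  by rewrite dset_parabolic ?(subsetP sHJ).
by exists c; rewrite // sL ?mem_cat ?Ec ?orbT -?wc.
Qed.

(** * Irreducible characters *)

Definition sign_z (b : bool) : int := if b then -1 else 1.

Lemma sign_zE b : (sign_z b)%:~R = (-1) ^+ b :> algC.
Proof. by case: b; rewrite ?expr1 ?rmorphN. Qed.

Definition eps_z (c : code) : int :=
  let: (b0, b1, b2, _) := c in sign_z (b0 (+) b1 (+) b2).
Definition delta_z (c : code) : int :=
  match c.2 with P021 | P102 | P210 => -1 | _ => 1 end.
Definition U_z (c : code) : int :=
  match c.2 with P012 => 2 | P120 | P201 => -1 | _ => 0 end.
Definition R_z (c : code) : int :=
  let: (b0, b1, b2, p) := c in
  match p with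
  | P012 => sign_z b0 + sign_z b1 + sign_z b2
  | P021 => sign_z b0 | P210 => sign_z b1 | P102 => sign_z b2
  | _ => 0
  end.

(** Integer values make identities and scalar products of class functions decidable by computation
    on the 48 codes. *)
Definition values (phi : CF3) (f : code -> int) : Prop :=
  forall c, phi (decode c) = (f c)%:~R.

Lemma values_eq phi psi f g : values phi f -> values psi g ->
  all (fun c => f c == g c) codes -> phi = psi.
Proof.
move=> Vf Vg /all_codes fg; apply/cfun_inP=> w Ww.
by rewrite -(encodeK Ww) Vf Vg (eqP (fg _)).
Qed.

Lemma values0 : values 0 (fun=> 0).
Proof. by move=> c; rewrite cfunE. Qed.

Lemma values1 : values 1 (fun=> 1).
Proof. by move=> c; rewrite cfun1E decode_B3. Qed.

Lemma valuesD phi psi f g : values phi f -> values psi g ->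
  values (phi + psi) (fun c => f c + g c).
Proof. by move=> Vf Vg c; rewrite cfunE Vf Vg rmorphD. Qed.

Lemma valuesM phi psi f g : values phi f -> values psi g ->
  values (phi * psi) (fun c => f c * g c).
Proof. by move=> Vf Vg c; rewrite cfunE Vf Vg rmorphM. Qed.

Lemma values_eps : values eps eps_z.
Proof.
move=> c; rewrite cfunE decode_B3 mulr1n /eps_fun -sum1_card big_mkcond.
rewrite !big_ord_recl big_ord0 !inE !neg_decode /=.
case: c => [[[b0 b1] b2] p]; rewrite sign_zE -signr_odd.
by case: b0 b1 b2 => [] [] [].
Qed.

Lemma sproj_decode c (i : 'I_3) : sproj (decode c) i = sym3_app c.2 i :> nat.
Proof. by rewrite sprojE ?decode_B3 // sproj_fun_decode. Qed.

Definition sym3_odd (p : sym3) : bool :=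
  match p with P021 | P102 | P210 => true | _ => false end.

Lemma odd_sproj c : sproj (decode c) = sym3_odd c.2 :> bool.
Proof.
pose t01 : 'S_3 := tperm o0 o1; pose t12 : 'S_3 := tperm o1 o2.
(* A word in adjacent transpositions displays the parity. *)
have -> : sproj (decode c) = match c.2 with
  | P012 => 1 | P021 => t12 | P102 => t01 | P120 => t12 * t01
  | P201 => t01 * t12 | P210 => t01 * t12 * t01 end%g.
  apply/permP=> i; apply/val_inj; rewrite /= sproj_decode.
  case: c => [_ []] /=; rewrite ?permM ?perm1 //;
  by case: i => [[|[|[|//]]] ?]; rewrite /t01 /t12 /tperm ?permE /= ?permE.
by case: c.2; rewrite ?odd_permM ?odd_tperm ?odd_perm1.
Qed.

Lemma values_delta : values delta delta_z.
Proof.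
move=> c; rewrite cfunE decode_B3 mulr1n /delta_fun odd_sproj.
by rewrite /delta_z; case: c.2; rewrite ?expr1 ?rmorphN.
Qed.

Lemma values_R : values R R_z.
Proof.
move=> c; rewrite cfunE decode_B3 mulr1n /mxtrace !big_ord_recl big_ord0 !mxE.
rewrite !neg_decode !sproj_fun_decode -!val_eqE /=.
case: c => [[[b0 b1] b2] []] /=;
  by rewrite ?rmorphD /= ?sign_zE ?mul1r ?mul0r ?add0r ?addr0 ?addrA.
Qed.

Lemma mult_fun_char (gT : finGroupType) (G : {group gT}) (phi : 'CF(G)) :
    phi 1%g = 1 ->
      {in G &, {morph phi : v w / (v * w)%g >-> v * w}} -> phi \is a linear_char.
Proof.
move=> phi1 phiM; rewrite qualifE /= phi1 eqxx andbT.
have repr : mx_repr G (fun w => (phi w)%:M : 'M_1).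
  by split=> [|v w Gv Gw]; rewrite ?phi1 // phiM // scalar_mxM.
have -> : phi = cfRepr (MxRepresentation repr).
  by apply/cfun_inP=> w Gw; rewrite cfunE Gw mulr1n /= mxtrace_scalar mulr1n.
exact: cfRepr_char.
Qed.

Lemma eps_lin : eps \is a linear_char.
Proof.
apply: mult_fun_char => [|v w Wv Ww].
  by rewrite -decode1 values_eps.
by rewrite !cfunE !groupM ?Wv ?Ww //= !mulr1n eps_funM.
Qed.

Lemma delta_lin : delta \is a linear_char.
Proof.
apply: mult_fun_char => [|v w Wv Ww].
  by rewrite -decode1 values_delta.
by rewrite !cfunE !groupM ?Wv ?Ww //= !mulr1n delta_funM.
Qed.

Section DegreeTwo.
Let G := [set: 'S_3].

Definition sgn_fun (s : 'S_3) : algC := (-1) ^+ s.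

Lemma sgn_repr : mx_repr G (fun s => (sgn_fun s)%:M : 'M_1).
Proof.
split=> [|s t _ _]; first by rewrite /sgn_fun odd_perm1.
by rewrite /sgn_fun odd_permM signr_addb -scalar_mxM.
Qed.

(* The degrees 1, 1, 2 of the trivial, sign and remaining characters exhaust  *)
(* the order 6 of S_3, so the regular character determines the latter.        *)
Lemma degree2E s :
  1 + sgn_fun s + 2 * 'chi_degree2_index s = 6%:R *+ (s == 1%g) :> algC.
Proof.
pose k := degree2_index.
have k2 : 'chi_k 1%g = 2 by apply/eqP; rewrite degree2_unique.
have sgnE t : cfRepr (MxRepresentation sgn_repr) t = sgn_fun t.
  by rewrite cfunE in_setT mulr1n /= mxtrace_scalar mulr1n.
have sgn1 : sgn_fun 1%g = 1 by rewrite /sgn_fun odd_perm1.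
have [j jE] : exists j : Iirr G, cfRepr (MxRepresentation sgn_repr) = 'chi_j.
  apply/irrP/lin_char_irr; rewrite qualifE /= cfRepr_char /=.
  by rewrite sgnE sgn1.
have j1 : 'chi_j 1%g = 1 by rewrite -jE sgnE.
have j0 : j != 0.
  apply/eqP=> jz; have := sgnE (tperm o0 o1); rewrite jE jz irr0 cfun1E in_setT.
  rewrite /sgn_fun odd_tperm /= expr1 => /eqP.
  by rewrite -subr_eq0 opprK -(natrD _ 1 1) pnatr_eq0.
have kj : k != j.
  apply/eqP=> kj; move: k2; rewrite kj j1 => /eqP.
  by rewrite eq_sym pnatr_eq1.
have k0 : k != 0.
  apply/eqP=> kz; move: k2; rewrite kz irr0 cfun11 => /eqP.
  by rewrite eq_sym pnatr_eq1.
have cG : #|G| = 6%N by rewrite cardsT card_Sn.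
(* A fourth irreducible character would push the sum of squared degrees above 1 + 1 + 4 = 6. *)
have out i : i != 0 -> i != j -> i != k -> False.
  move=> i0 ij ik; have := irr_sum_square G.
  rewrite (bigD1 0) // (bigD1 j) // (bigD1 k) ?k0 //= (bigD1 i) ?i0 ?ij ?ik //=.
  rewrite irr0 cfun11 j1 k2 cG => E.
  set y := 'chi_i 1%g ^+ 2 + _ in E.
  have y_gt0 : 0 < y.
    apply: ltr_wpDr; last by rewrite exprn_gt0 ?irr1_gt0.
    by apply: sumr_ge0 => l _; rewrite exprn_ge0 // ltW ?irr1_gt0.
  have y0 : y = 1 ^+ 2 + (1 ^+ 2 + (2 ^+ 2 + y)) - 6 by ring.
  by rewrite y0 E subrr ltxx in y_gt0.
have := cfRegE G s; rewrite cfReg_sum sum_cfunE.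
rewrite (bigD1 0) // (bigD1 j) // (bigD1 k) ?k0 //=.
rewrite big1 => [|i /andP[/andP[i0 ij] ik]].
  rewrite !cfunE irr0 cfun11 j1 k2 cG cfun1E in_setT -jE sgnE !mul1r addr0.
  by rewrite addrA.
by case: (out i).
Qed.

End DegreeTwo.

Lemma values_U : values U U_z.
Proof.
move=> c; rewrite /U cfMorphE ?subxx ?decode_B3 // cfResE ?subsetT //; last first.
  exact: mem_morphim (decode_B3 c) (decode_B3 c).
have := degree2E (sproj (decode c)); rewrite /sgn_fun odd_sproj.
have -> : (sproj (decode c) == 1%g) = (c.2 == P012).
  apply/eqP/eqP => [/permP sc | c2].
    have := congr1 val (sc o0); have := congr1 val (sc o1).
    by rewrite /= !sproj_decode !perm1; case: c.2.
  apply/permP=> i; apply/val_inj; rewrite /= sproj_decode perm1 c2.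
  by case: i => [[|[|[|]]]].
move=> E; have two0 : 2 != 0 :> algC by rewrite pnatr_eq0.
apply: (mulfI two0); move: E; rewrite /U_z; set x := _ (sproj _) => E.
have -> : 2 * x = 1 + (-1) ^+ sym3_odd c.2 + 2 * x -
    (1 + (-1) ^+ sym3_odd c.2) by ring.
by rewrite E; case: c.2 => /=; rewrite ?expr0 ?expr1 ?mulr1n ?mulr0n; ring.
Qed.

Definition irr10 : seq CF3 :=
  [:: 1; delta; eps; omega; U; eps * U; R; eps * R; delta * R; omega * R].

Definition irr_z (c : code) : seq int :=
  let e := eps_z c in let d := delta_z c in let u := U_z c in let r := R_z c in
  [:: 1; d; e; e * d; u; e * u; r; e * r; d * r; e * d * r].

Lemma values_irr10 k : values (nth 0 irr10 k) (fun c => nth 0 (irr_z c) k).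
Proof.
have Ve := values_eps; have Vd := values_delta; have Vo := valuesM Ve Vd.
have VR := values_R; have VU := values_U.
case: k => [|[|[|[|[|[|[|[|[|[|k]]]]]]]]]]; rewrite /=.
- exact: values1.
- exact: Vd.
- exact: Ve.
- exact: Vo.
- exact: VU.
- exact: valuesM Ve VU.
- exact: VR.
- exact: valuesM Ve VR.
- exact: valuesM Vd VR.
- exact: valuesM Vo VR.
- by move=> c; rewrite !nth_nil cfunE.
Qed.

Lemma cfdot_values (G : {group {perm spoint}}) (phi psi : 'CF(G)) K f g :
    uniq K -> gval G =i dset K ->
    {in K, forall c, phi (decode c) = (f c)%:~R} ->
    {in K, forall c, psi (decode c) = (g c)%:~R} ->
  '[phi, psi] = (size K)%:R^-1 * (\sum_(c <- K) f c * g c)%:~R.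
Proof.
move=> uK GK Vf Vg; rewrite cfdotE (card_dset uK GK) (big_dset _ _ uK GK).
congr (_ * _); rewrite rmorph_sum /= big_seq [RHS]big_seq; apply: eq_bigr => c Kc.
by rewrite Vf // Vg // rmorphM /= [X in _ * X]conj_intr.
Qed.

Lemma irr10_char k : (k < 10)%N -> nth 0 irr10 k \is a character.
Proof.
have Ne := lin_charW eps_lin; have Nd := lin_charW delta_lin.
have No : omega \is a character := rpredM Ne Nd.
have NR : R \is a character by apply: cfRepr_char.
have NU : U \is a character by rewrite cfMorph_char // cfRes_char // irr_char.
by do 10?[case: k => [|k]; first by rewrite /= ?rpredM ?rpred1].
Qed.

Lemma irr10_orthonormal k l : (k < 10)%N -> (l < 10)%N ->
  '[nth 0 irr10 k, nth 0 irr10 l] = (k == l)%:R.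
Proof.
move=> lk ll; have V := values_irr10.
rewrite (cfdot_values (K := codes) codes_uniq _ (in1W (V k)) (in1W (V l)));
  last first.
  by move=> w; rewrite dset_codes.
have -> : \sum_(c <- codes) nth 0 (irr_z c) k * nth 0 (irr_z c) l =
    (48 * (k == l))%N%:Z.
  apply/eqP; rewrite unlock.
  suff : all (fun i => all (fun j => foldr
     (fun c z => nth 0 (irr_z c) i * nth 0 (irr_z c) j + z) 0 codes ==
       (48 * (i == j))%N%:Z) (iota 0 10)) (iota 0 10).
    move/allP/(_ k); rewrite mem_iota => /(_ lk)/allP/(_ l).
    by rewrite mem_iota; apply.
  by vm_compute.
by rewrite -[size _]/48%N -pmulrn natrM mulKf // pnatr_eq0.
Qed.

Local Notation X := (nth (0 : CF3) irr10).

Lemma irr10_irr k : (k < 10)%N -> X k \in irr B3.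
Proof.
by move=> lk; rewrite irrEchar irr10_char //= irr10_orthonormal ?eqxx.
Qed.

Lemma values_sum (I : Type) (r : seq I) (F : I -> CF3) (f : I -> code -> int) :
  (forall i, values (F i) (f i)) ->
  values (\sum_(i <- r) F i) (fun c => \sum_(i <- r) f i c).
Proof.
by move=> V c; rewrite sum_cfunE rmorph_sum; apply: eq_bigr => i _; apply: V.
Qed.

(** The ten characters, weighted by their degrees, already add up to the regular character. An
    irreducible character outside the list would be orthogonal to it, whereas its multiplicity there
    is its nonzero degree. *)
Lemma irr10_complete (i : Iirr B3) : exists2 k, (k < 10)%N & 'chi_i = X k.
Proof.
pose f k c : int := nth 0 (irr_z code1) k * nth 0 (irr_z c) k.
have reg : cfReg B3 = \sum_(k <- iota 0 10) X k 1%g *: X k.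
  apply/cfun_inP=> w Ww; rewrite -(encodeK Ww); move: (encode w) => c.
  rewrite sum_cfunE cfRegE (card_dset codes_uniq (A := B3)); last first.
    by move=> v; rewrite dset_codes.
  rewrite (eq_bigr (fun k => (f k c)%:~R)) => [|k _]; last first.
    by rewrite cfunE -decode1 !values_irr10 -rmorphM.
  rewrite -rmorph_sum /= -decode1 (inj_eq decode_inj).
  have /all_codes/(_ c)/eqP-> : all (fun c =>
     \sum_(k <- iota 0 10) f k c == (48 * (c == code1))%N%:Z) codes.
    by rewrite unlock; vm_compute.
  by rewrite -pmulrn natrM mulr_natr.
have [/hasP[k]|/hasPn no] := boolP (has (fun k => 'chi_i == X k) (iota 0 10)).
  by rewrite mem_iota => lk /eqP->; exists k.
have : '[cfReg B3, 'chi_i] = 0.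
  rewrite reg cfdot_suml big_seq big1 // => k ik; rewrite cfdotZl.
  have lk : (k < 10)%N by rewrite mem_iota in ik.
  have [j jk] := irrP (irr10_irr lk).
  rewrite jk cfdot_irr; case: eqP => [ji|_]; last by rewrite mulr0.
  by have := no k ik; rewrite jk ji eqxx.
rewrite cfReg_sum cfdot_suml (bigD1 i) //= big1 => [|j /negPf ji].
  rewrite cfdotZl cfdot_irr eqxx mulr1 addr0 => /eqP.
  by rewrite (negPf (irr1_neq0 i)).
by rewrite cfdotZl cfdot_irr ji mulr0.
Qed.

Lemma cf3_eq (phi psi : CF3) :
  (forall k, (k < 10)%N -> '[phi, X k] = '[psi, X k]) -> phi = psi.
Proof.
move=> E; rewrite [phi]cfun_sum_cfdot [RHS]cfun_sum_cfdot.
by apply: eq_bigr => i _; have [k lk ->] := irr10_complete i; rewrite E.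
Qed.

(** * Multiplicity-free characters as subsets of the ten irreducible characters *)

Definition mask_cf (m : seq bool) : CF3 :=
  \sum_(k <- iota 0 10) X k *+ nth false m k.

Definition cf_mask (phi : CF3) : seq bool :=
  [seq '[phi, X k] == 1 | k <- iota 0 10].

Lemma cfdot_mask m k : (k < 10)%N -> '[mask_cf m, X k] = (nth false m k)%:R.
Proof.
move=> lk; rewrite cfdot_suml (bigD1_seq k) ?iota_uniq ?mem_iota //.
rewrite big_seq_cond big1.
  by rewrite /= addr0 -scaler_nat cfdotZl irr10_orthonormal // eqxx mulr1.
move=> j /andP[]; rewrite mem_iota => lj /negPf jk.
by rewrite -scaler_nat cfdotZl irr10_orthonormal // jk mulr0.
Qed.

Lemma mask_cfK m : size m = 10 -> cf_mask (mask_cf m) = m.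
Proof.
move=> sm; apply: (@eq_from_nth _ false); rewrite size_map size_iota // => k lk.
rewrite (nth_map 0) ?size_iota // nth_iota // cfdot_mask //.
by case: (nth _ _ _); rewrite ?eqxx // eq_sym oner_eq0.
Qed.

Lemma cf_maskK phi : (forall k, (k < 10)%N -> '[phi, X k] \in [:: 0; 1]) ->
  mask_cf (cf_mask phi) = phi.
Proof.
move=> phi01; apply: cf3_eq => k lk; rewrite cfdot_mask //.
rewrite (nth_map 0) ?size_iota // nth_iota //.
have := phi01 k lk; rewrite !inE => /pred2P[] ->; rewrite ?eqxx //.
by rewrite eq_sym oner_eq0.
Qed.

Lemma cfdot_sum_irr k : (k < 10)%N -> '[\sum_(i : Iirr B3) 'chi_i, X k] = 1.
Proof.
move=> lk; have [i ->] := irrP (irr10_irr lk).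
rewrite cfdot_suml (bigD1 i) //= big1 ?cfdot_irr ?eqxx ?addr0 // => j /negPf ji.
by rewrite cfdot_irr ji.
Qed.

Lemma sum_mask_cf (ms : seq (seq bool)) :
  (\sum_(m <- ms) mask_cf m == \sum_(i : Iirr B3) 'chi_i) =
  all (fun k => count (fun m => nth false m k) ms == 1)%N (iota 0 10).
Proof.
have E k : (k < 10)%N ->
    '[\sum_(m <- ms) mask_cf m, X k] = (count (fun m => nth false m k) ms)%:R.
  move=> lk; rewrite cfdot_suml -sum1_count natr_sum [RHS]big_mkcond.
  by apply: eq_bigr => m _; rewrite /= cfdot_mask //; case: nth.
apply/eqP/allP => [eqS k | all1].
  rewrite mem_iota => lk; rewrite -(eqr_nat algC) -E //.
  by rewrite eqS cfdot_sum_irr.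
apply: cf3_eq => k lk; rewrite E // cfdot_sum_irr //.
by rewrite (eqP (all1 k _)) // mem_iota.
Qed.

(** * Induced characters *)

Definition simple_subsets : seq (seq code) :=
  [:: [::]; [:: code_s0]; [:: code_s1]; [:: code_s0; code_s1]; [:: code_s2];
      [:: code_s0; code_s2]; [:: code_s1; code_s2];
      [:: code_s0; code_s1; code_s2]].

Lemma simple_subsets_ok J : J \in simple_subsets -> simple_subset J.
Proof. by apply/allP: J; vm_compute. Qed.

Lemma B3_SE : B3_S = dset [:: code_s0; code_s1; code_s2].
Proof.
have E0 : B3_s0 = decode code_s0.
  apply/permP=> -[b i]; rewrite /B3_s0 sflipE decodeE coordE.
  by case: i => [[|[|[|//]]] ?]; congr pair; apply/val_inj.
have E1 : B3_s1 = decode code_s1.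
  apply/permP=> -[b i]; rewrite /B3_s1 spliftE decodeE !coordE /tperm permE.
  by case: i => [[|[|[|//]]] ?]; congr pair; rewrite ?addbF //; apply/val_inj.
have E2 : B3_s2 = decode code_s2.
  apply/permP=> -[b i]; rewrite /B3_s2 spliftE decodeE !coordE /tperm permE.
  by case: i => [[|[|[|//]]] ?]; congr pair; rewrite ?addbF //; apply/val_inj.
by apply/setP=> w; rewrite !inE E0 E1 E2 orbA.
Qed.

Lemma simple_subsetsP (J : {set {perm spoint}}) :
  reflect (exists2 L, L \in simple_subsets & J = dset L) (J \subset B3_S).
Proof.
apply: (iffP idP) => [sJ | [L LS ->]]; last first.
  have /allP/(_ L LS)/allP sL : all (fun L => all
     [in [:: code_s0; code_s1; code_s2]] L) simple_subsets by vm_compute.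
  by rewrite B3_SE; apply/subsetP=> _ /dsetP[c Lc ->]; rewrite mem_dset sL.
exists [seq c <- [:: code_s0; code_s1; code_s2] | decode c \in J].
  by rewrite /=; do 3!case: (_ \in J).
apply/setP=> w; apply/idP/dsetP => [Jw | [c + ->]].
  have := subsetP sJ w Jw; rewrite B3_SE => /dsetP[c Sc wc].
  by exists c; rewrite // mem_filter -wc Jw.
by rewrite mem_filter => /andP[].
Qed.

Lemma lin_irr10 t : (t < 4)%N -> X t \is a linear_char.
Proof.
case: t => [|[|[|[|//]]]] _ /=; rewrite ?cfun1_lin_char ?delta_lin ?eps_lin //.
by rewrite rpredM ?delta_lin ?eps_lin.
Qed.

Lemma dset_sub_B3 J : <<dset J>>%g \subset B3.
Proof.
by rewrite gen_subG; apply/subsetP=> _ /dsetP[c _ ->]; apply: decode_B3.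
Qed.

Lemma lin_restrict J (sigma : 'CF(<<dset J>>)) : J \in simple_subsets ->
    sigma \is a linear_char ->
  exists2 t, (t < 4)%N & {in <<dset J>>%g, sigma =1 X t}.
Proof.
move=> JS sl; have sJ := simple_subsets_ok JS.
have sgn s : s \in J -> sigma (decode s) = 1 \/ sigma (decode s) = -1.
  move=> Js; have Gs : decode s \in <<dset J>>%g by rewrite mem_gen ?mem_dset.
  have /eqP : sigma (decode s) ^+ 2 = 1.
    by rewrite expr2 -lin_charM // (simple_dset sJ) ?mem_dset // lin_char1.
  by rewrite sqrf_eq1 => /pred2P.
(* The braid relation of length three forces equal signs on s_1 and s_2; the sign on s_0 remains
   independent of these. *)
have braid : code_s1 \in J -> code_s2 \in J ->
    sigma (decode code_s1) = sigma (decode code_s2).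
  move=> J1 J2.
  have G1 : decode code_s1 \in <<dset J>>%g by rewrite mem_gen ?mem_dset.
  have G2 : decode code_s2 \in <<dset J>>%g by rewrite mem_gen ?mem_dset.
  have : sigma (decode code_s1 * (decode code_s2 * decode code_s1))%g =
      sigma (decode code_s2 * (decode code_s1 * decode code_s2))%g.
    by rewrite -!decodeM.
  rewrite !lin_charM ?groupM //.
  case: (sgn _ J1) => ->; case: (sgn _ J2) => -> //;
  by rewrite ?(mul1r, mulr1, mulN1r, mulrN1, opprK).
(* In [irr10] the linear character of index 2a + b is eps^a delta^b; eps is -1 only on s_0 among the
   simple generators, and delta only on s_1 and s_2. *)
pose a := (code_s0 \in J) && (sigma (decode code_s0) == -1).
pose b := (code_s1 \in J) && (sigma (decode code_s1) == -1) ||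
          (code_s2 \in J) && (sigma (decode code_s2) == -1).
have lt4 (x y : bool) : (x.*2 + y < 4)%N by case: x y => [] [].
pose t := (a.*2 + b)%N; have lt : (t < 4)%N := lt4 a b.
exists t => //.
have N1 : 1 == -1 :> algC = false.
  by apply/negbTE; rewrite -subr_eq0 opprK -(natrD _ 1 1) pnatr_eq0.
have agree s : s \in J -> sigma (decode s) = X t (decode s).
  move=> Js; rewrite values_irr10.
  have : s \in [:: code_s0; code_s1; code_s2].
    have /allP/(_ J JS)/allP sL : all (fun L => all
      [in [:: code_s0; code_s1; code_s2]] L) simple_subsets by vm_compute.
    exact: sL.
  have sgnb c : c \in J -> sigma (decode c) = (-1) ^+ (sigma (decode c) == -1).
    by case/sgn=> ->; rewrite ?N1 ?eqxx ?expr0 ?expr1.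
  rewrite !inE => /or3P[] /eqP Es; rewrite Es in Js *;
    rewrite sgnb // /t /a /b Js /=.
  - case: (sigma (decode code_s0) == -1); case: (_ || _) => /=;
    by rewrite ?expr0 ?expr1 ?rmorphN.
  - have -> : (sigma (decode code_s1) == -1) || (code_s2 \in J) &&
        (sigma (decode code_s2) == -1) = (sigma (decode code_s1) == -1).
      by case: (boolP (code_s2 \in J)) => [/(braid Js)->|_]; rewrite ?orbb ?orbF.
    case: (sigma (decode code_s1) == -1); case: (_ && _) => /=;
    by rewrite ?expr0 ?expr1 ?rmorphN.
  - have -> : (code_s1 \in J) && (sigma (decode code_s1) == -1) ||
        (sigma (decode code_s2) == -1) = (sigma (decode code_s2) == -1).
      by case: (boolP (code_s1 \in J)) => [/braid/(_ Js)->|_]; rewrite ?orbb.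
    case: (sigma (decode code_s2) == -1); case: (_ && _) => /=;
    by rewrite ?expr0 ?expr1 ?rmorphN.
have /subsetP W3 := dset_sub_B3 J; have tl := lin_irr10 lt.
have grp : group_set [set w in <<dset J>>%g | sigma w == X t w].
  apply/group_setP; split=> [|v w]; rewrite !inE ?group1 ?lin_char1 ?eqxx //.
  case/andP=> Gv /eqP sv /andP[Gw /eqP sw].
  by rewrite groupM //= !lin_charM ?W3 // sv sw.
move=> w Gw; apply/eqP.
suff: w \in Group grp by rewrite inE => /andP[].
apply: subsetP Gw; rewrite gen_subG; apply/subsetP=> _ /dsetP[c Jc ->].
by rewrite inE mem_gen ?mem_dset //= agree.
Qed.

(* The index of [X t * X k] in [irr10], for [X t] linear. *)
Definition twist (t k : nat) : nat :=
  nth 0 (nth [::] [:: [:: 0; 1; 2; 3; 4; 5; 6; 7; 8; 9];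
                      [:: 1; 0; 3; 2; 4; 5; 8; 9; 6; 7];
                      [:: 2; 3; 0; 1; 5; 4; 7; 6; 9; 8];
                      [:: 3; 2; 1; 0; 5; 4; 9; 8; 7; 6]] t) k.

Definition restriction_sums (K : seq code) : seq int :=
  [seq foldr (fun c z => nth 0 (irr_z c) k + z) 0 K | k <- iota 0 10].

(** By Frobenius reciprocity these are the multiplicities in the induced character times the order
    of the subgroup, which keeps them integral; twisting only permutes the untwisted sums. *)
Definition induced_sums (K : seq code) (t : nat) : seq int :=
  let s := restriction_sums K in [seq nth 0 s (twist t k) | k <- iota 0 10].

Definition mult_free (n : nat) (v : seq int) : bool :=
  all (fun z => (z == 0) || (z == n%:Z)) v.

Definition sums_mask (n : nat) (v : seq int) : seq bool :=
  [seq z == n%:Z | z <- v].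

Lemma twistE t k c : (t < 4)%N -> (k < 10)%N ->
  nth 0 (irr_z c) t * nth 0 (irr_z c) k = nth 0 (irr_z c) (twist t k).
Proof.
move=> lt lk.
have /allP/(_ t) : all (fun t => all (fun k => all (fun c =>
   nth 0 (irr_z c) t * nth 0 (irr_z c) k == nth 0 (irr_z c) (twist t k)) codes)
   (iota 0 10)) (iota 0 4) by vm_compute.
rewrite mem_iota => /(_ lt)/allP/(_ k); rewrite mem_iota => /(_ lk).
by move/all_codes/(_ c)/eqP.
Qed.

Lemma twist_lt t k : (t < 4)%N -> (k < 10)%N -> (twist t k < 10)%N.
Proof.
move=> lt lk.
have /allP/(_ t) : all (fun t => all (fun k => twist t k < 10)%N (iota 0 10))
  (iota 0 4) by vm_compute.
by rewrite mem_iota => /(_ lt)/allP/(_ k); rewrite mem_iota; apply.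
Qed.

Lemma induced_sumsE K t k : (t < 4)%N -> (k < 10)%N ->
  nth 0 (induced_sums K t) k =
  \sum_(c <- K) nth 0 (irr_z c) t * nth 0 (irr_z c) k.
Proof.
move=> lt lk; rewrite (nth_map 0%N) ?size_iota // nth_iota //.
rewrite (nth_map 0%N) ?size_iota ?twist_lt // nth_iota ?twist_lt //.
under eq_bigr => c _ do rewrite twistE //.
by rewrite unlock.
Qed.

Section Induced.
Variables (J K : seq code) (H : {group {perm spoint}}).
Variable sigma : 'CF(<<dset J>>).
Variable t : nat.
Hypotheses (uK : uniq K) (HK : gval H =i dset K) (sHJ : H \subset <<dset J>>%g).
Hypotheses (lt4 : (t < 4)%N) (sigmaE : {in <<dset J>>%g, sigma =1 X t}).

Let phi : CF3 := 'Ind[B3, H] ('Res[H, <<dset J>>] sigma).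

Lemma cfdot_induced k : (k < 10)%N ->
  '[phi, X k] = (size K)%:R^-1 * (nth 0 (induced_sums K t) k)%:~R.
Proof.
move=> lk; rewrite -Frobenius_reciprocity induced_sumsE //.
have sHW := subset_trans sHJ (dset_sub_B3 J).
apply: cfdot_values => // c Kc.
  have Hc : decode c \in H by rewrite HK mem_dset.
  by rewrite cfResE // sigmaE ?values_irr10 // (subsetP sHJ).
by rewrite cfResE ?values_irr10 // HK mem_dset.
Qed.

Lemma size_codes_gt0 : (0 < size K)%N.
Proof. by rewrite -(card_dset uK HK). Qed.

Lemma cfdot_induced_eq k n : (k < 10)%N ->
  ('[phi, X k] == n%:R) = (nth 0 (induced_sums K t) k == (size K * n)%N%:Z).
Proof.
move=> lk; rewrite cfdot_induced //.
have n0 : (size K)%:R != 0 :> algC by rewrite pnatr_eq0 -lt0n size_codes_gt0.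
rewrite -(inj_eq (mulfI n0)) mulVKf // -natrM pmulrn.
by rewrite eqr_int.
Qed.

Lemma cfdot_induced01 k : (k < 10)%N ->
  ('[phi, X k] \in [:: 0; 1]) =
  (nth 0 (induced_sums K t) k == 0) ||
  (nth 0 (induced_sums K t) k == (size K)%:Z).
Proof.
move=> lk; rewrite !inE (cfdot_induced_eq 0) // (cfdot_induced_eq 1) //.
by rewrite muln0 muln1.
Qed.

Lemma induced_mult_free :
  (forall k, (k < 10)%N -> '[phi, X k] \in [:: 0; 1]) <->
  mult_free (size K) (induced_sums K t).
Proof.
have sz : size (induced_sums K t) = 10 by rewrite size_map size_iota.
split=> [mf | /(all_nthP 0) mf k lk].
  by apply/(all_nthP 0) => k; rewrite sz => lk; rewrite -cfdot_induced01 ?mf.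
by rewrite cfdot_induced01 // mf ?sz.
Qed.

Lemma cf_mask_induced : cf_mask phi = sums_mask (size K) (induced_sums K t).
Proof.
rewrite /sums_mask /induced_sums -map_comp; apply/eq_in_map => k.
rewrite mem_iota => lk; rewrite (cfdot_induced_eq 1) // muln1 /=; congr (_ == _).
by rewrite (nth_map 0%N) ?size_iota // nth_iota.
Qed.

Lemma induced_mask : mult_free (size K) (induced_sums K t) ->
  phi = mask_cf (sums_mask (size K) (induced_sums K t)).
Proof.
by move=> mf; rewrite -cf_mask_induced cf_maskK //; apply/induced_mult_free.
Qed.

End Induced.

(** * Exact covers *)

Definition twisted_mask (st : seq nat * nat) : seq bool :=
  let s := map (twist st.2) st.1 in [seq k \in s | k <- iota 0 10].

(* Representatives, up to twists by linear characters, of the                 *)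
(* multiplicity-free characters induced from quasiparabolic subgroups.        *)
Definition basic_supports : seq (seq nat) :=
  [:: [:: 0]; [:: 0; 1]; [:: 0; 2]; [:: 0; 3]; [:: 0; 1; 2; 3]; [:: 0; 4];
      [:: 0; 2; 4; 5]; [:: 0; 3; 4; 5]; [:: 0; 4; 6]; [:: 0; 7];
      [:: 0; 2; 6; 7]; [:: 0; 3; 7; 8]; [:: 0; 4; 6; 7; 8];
      [:: 0; 2; 4; 5; 6; 7]; [:: 0; 3; 4; 5; 6; 9];
      [:: 0; 1; 2; 3; 6; 7; 8; 9]]%N.

Definition allowed_masks : seq (seq bool) :=
  undup [seq twisted_mask (s, t) | s <- basic_supports, t <- iota 0 4].

(** The test of quasiparabolicity is run only if some multiplicity-free induced character has a mask
    outside the list. *)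
Definition allowed_group (J K : seq code) : bool :=
  let n := size K in
  let mask_ok t := let v := induced_sums K t in
    mult_free n v ==> (sums_mask n v \in allowed_masks) in
  if uniq K then
    if all mask_ok (iota 0 4) then true else ~~ qp_codes J K
  else false.

Lemma search_allowed_groups : all (fun J =>
  search (allowed_group J) [::] [::] [:: code1] (parabolic J)) simple_subsets.
Proof. by vm_compute. Qed.

Lemma allowed_mask (phi : CF3) : allowed_character B3_S phi ->
    (forall k, (k < 10)%N -> '[phi, X k] \in [:: 0; 1]) ->
  cf_mask phi \in allowed_masks.
Proof.
move=> [I [H [sigma [/simple_subsetsP[J JS IJ] [sHJ qpH] sl ->]]]] mf.
subst I.
have [t lt sigmaE] := lin_restrict JS sl; have sJ := simple_subsets_ok JS.
have [K + HK] := search_subgroup sJ sHJ (allP search_allowed_groups J JS).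
rewrite /allowed_group; case: ifP => // uK.
have -> : qp_codes J K by apply/(qp_codesP sJ uK HK sHJ).
case: ifP => // /allP ok _.
rewrite (cf_mask_induced uK HK sHJ lt sigmaE).
have := ok t; rewrite mem_iota => /(_ lt)/implyP; apply.
exact/(induced_mult_free uK HK sHJ lt sigmaE).
Qed.

Lemma allowed_char (phi : CF3) :
  allowed_character B3_S phi -> phi \is a character.
Proof.
by case=> [J [H [sigma [_ _ sl ->]]]]; rewrite cfInd_char ?cfRes_char ?lin_charW.
Qed.

Definition sub_mask (m rest : seq bool) : bool :=
  all (fun j => nth false m j ==> nth false rest j) (iota 0 10).

Definition diff_mask (rest m : seq bool) : seq bool :=
  [seq nth false rest j && ~~ nth false m j | j <- iota 0 10].

Section Covers.
Variable masks : seq (seq bool).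

(* [ks] lists the indices at which [rest], the part still to be covered, may  *)
(* be nonzero; the first one forces the choice of the next mask.              *)
Fixpoint covers (ks : seq nat) (rest : seq bool) : seq (seq (seq bool)) :=
  if ks is k :: ks' then
    if nth false rest k then
      flatten [seq [seq m :: c | c <- covers ks' (diff_mask rest m)]
        | m <- [seq m <- masks | nth false m k && sub_mask m rest]]
    else covers ks' rest
  else [:: [::]].

Hypothesis masks_neq0 :
  all (fun m => has (fun j => nth false m j) (iota 0 10)) masks.

(** The first uncovered index lies in some member of the cover; removing that member leaves an exact
    cover of the difference, to which induction applies. Hence every exact cover is found up to
    order. *)
Lemma coversP ks rest (ms : seq (seq bool)) :
    all (fun k => k < 10)%N ks -> all [in masks] ms ->
    (forall j, (j < 10)%N ->
      count (fun m => nth false m j) ms = nth false rest j) ->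
    (forall j, (j < 10)%N -> nth false rest j -> j \in ks) ->
  has (perm_eq ms) (covers ks rest).
Proof.
elim: ks rest ms => [|k ks IHks] rest ms /=.
  (* With nothing left to cover, a remaining mask would have to be empty. *)
  move=> _ Mms cnt rest0; case: ms Mms cnt => [|m ms] //= /andP[Mm _] cnt.
  have : has (fun j => nth false m j) (iota 0 10).
    exact: (allP masks_neq0 m Mm).
  case/hasP=> j; rewrite mem_iota => lj mj; have := cnt j lj.
  by rewrite mj; case: (boolP (nth false rest j)) => // /(rest0 j lj).
case/andP=> lk lks Mms cnt rest_ks; case: ifP => rk; last first.
  apply: IHks => // j lj rj; have := rest_ks j lj rj; rewrite inE.
  by case: eqP => [jk|//]; rewrite jk rk in rj.
have : has (fun m => nth false m k) ms by rewrite has_count cnt // rk.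
case/hasP=> m ms_m mk; have pm := perm_to_rem ms_m.
have cnt' j : (j < 10)%N ->
    nat_of_bool (nth false m j) + count (fun m => nth false m j) (rem m ms) =
    nat_of_bool (nth false rest j).
  by move=> lj; rewrite -cnt // (seq.permP pm).
pose rest' := diff_mask rest m.
have rest'E j : (j < 10)%N ->
    nth false rest' j = nth false rest j && ~~ nth false m j.
  by move=> lj; rewrite (nth_map 0%N) ?size_iota // nth_iota.
have /hasP[c Cc pc] : has (perm_eq (rem m ms)) (covers ks rest').
  apply: IHks => // [|j lj|j lj].
  - by apply/allP=> m' /mem_rem; apply: (allP Mms).
  - rewrite rest'E //; have := cnt' j lj.
    by case: (nth false m j) (nth false rest j) => [] [] /=; lia.
  rewrite rest'E // => /andP[rj mj]; have := rest_ks j lj rj.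
  by rewrite inE => /predU1P[jk|//]; rewrite jk mk in mj.
apply/hasP; exists (m :: c); last by rewrite (permPl pm) perm_cons.
apply/flatten_mapP; exists m; last by apply: map_f.
rewrite mem_filter mk andTb (allP Mms _ ms_m : m \in masks) andbT.
apply/allP=> j; rewrite mem_iota => lj; apply/implyP=> mj.
by have := cnt' j lj; rewrite mj; case: (nth false rest j).
Qed.

End Covers.

(** * Realizations *)

Section GroupOfCodes.
Variables (J K : seq code).
Hypotheses (sJ : simple_subset J) (uK : uniq K) (gK : group_codes K).
Hypothesis sKJ : all [in parabolic J] K.

Definition group_of_codes : {group {perm spoint}} := Group (group_codesP gK).

Lemma group_of_codes_sub : group_of_codes \subset <<dset J>>%g.
Proof.
apply/subsetP=> _ /dsetP[c Kc ->]; rewrite mem_parabolic //; exact: (allP sKJ).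
Qed.

End GroupOfCodes.

Lemma lin_codes J t : (t < 4)%N ->
  {sigma : 'CF(<<dset J>>) | sigma \is a linear_char &
     {in <<dset J>>%g, sigma =1 nth (0 : CF3) irr10 t}}.
Proof.
move=> lt; have sJ := dset_sub_B3 J.
exists ('Res[<<dset J>>%G] (nth (0 : CF3) irr10 t)).
  exact/cfRes_lin_char/lin_irr10.
by move=> w Jw; rewrite cfResE.
Qed.

Definition allowed_cert (JKt : seq code * seq code * nat) : bool :=
  let: (J, K, t) := JKt in
  [&& J \in simple_subsets, uniq K, group_codes K, all [in parabolic J] K,
      qp_codes J K, (t < 4)%N & mult_free (size K) (induced_sums K t)].

Definition allowed_cert_mask (JKt : seq code * seq code * nat) : seq bool :=
  let: (_, K, t) := JKt in sums_mask (size K) (induced_sums K t).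

Lemma allowed_certP JKt :
  allowed_cert JKt -> allowed_character B3_S (mask_cf (allowed_cert_mask JKt)).
Proof.
case: JKt => [[J K] t] /and4P[JS uK gK /and4P[sKJ qpK lt mf]].
have sJ := simple_subsets_ok JS.
have sHJ := group_of_codes_sub sJ gK sKJ.
have [sigma sl sigmaE] := lin_codes J lt.
exists (dset J), (group_of_codes gK), sigma; split=> //.
- by apply/simple_subsetsP; exists J.
- exact/(qp_codesP sJ uK _ sHJ).
- by rewrite (induced_mask uK _ sHJ lt sigmaE).
Qed.

Definition code_centralizer (J : seq code) (z : code) : seq code :=
  [seq c <- parabolic J | code_mul c z == code_mul z c].

(** Here z lies in W_J itself, so its diagram automorphism is trivial. In the minimality clause, w c
    = z w says that c is the conjugate of z by w. *)
Definition perfect_cert (Jzt : seq code * code * nat) : bool :=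
  let: (J, z, t) := Jzt in
  let E := parabolic J in
  let K := code_centralizer J z in
  let l := code_length J in
  [&& J \in simple_subsets, z \in E, code_mul z z == code1,
    all (fun r => let c := code_mul z r in let d := code_mul c c in
      code_mul d d == code1) (code_reflections J E),
    all (fun w => all (fun c =>
      (code_mul w c == code_mul z w) ==> (l z <= l c)%N) E) E,
    (t < 4)%N & mult_free (size K) (induced_sums K t)].

Definition perfect_cert_mask (Jzt : seq code * code * nat) : seq bool :=
  let: (J, z, t) := Jzt in
  let K := code_centralizer J z in sums_mask (size K) (induced_sums K t).

Lemma parabolic_uniq J : uniq (parabolic J).
Proof. exact: filter_uniq codes_uniq. Qed.

Lemma ext_length_inj (S : {set {perm spoint}}) w : w \in <<S>>%g ->
  ext_length (cox_inj S w) = cox_length S w.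
Proof. by move=> Sw; rewrite /ext_length /cox_inj val_insubd inE group1 Sw. Qed.

Lemma perfect_certP Jzt :
  perfect_cert Jzt -> perfect_character B3_S (mask_cf (perfect_cert_mask Jzt)).
Proof.
case: Jzt => [[J z] t] /and4P[JS Ez zz /and4P[pz mz lt mf]].
have sJ := simple_subsets_ok JS.
have Gz : decode z \in <<dset J>>%g by rewrite mem_parabolic.
have [sigma sl sigmaE] := lin_codes J lt.
pose Z := cox_inj (dset J) (decode z).
(* W_J embeds injectively in the semidirect product, so commuting with Z there is commuting with z
   in W_J. *)
have HK : gval (perfect_centralizer Z) =i dset (code_centralizer J z).
  move=> w; apply/morphpreP/dsetP => [[Gw /cent1P Zw]|[c + ->]].
    have /dsetP[c Ec wc] : w \in dset (parabolic J) by rewrite dset_parabolic.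
    exists c => //; rewrite mem_filter Ec andbT -(inj_eq decode_inj) !decodeM -wc.
    have inj := injmP (injm_sdpair1 (diagram_action (dset J))).
    by apply/eqP/inj; rewrite ?groupM // !morphM.
  rewrite mem_filter => /andP[/eqP cz Ec]; have Gc : decode c \in <<dset J>>%g.
    by rewrite mem_parabolic.
  split=> //; apply/cent1P; rewrite /commute /Z /cox_inj -!morphM //.
  by rewrite -!decodeM cz.
have uK : uniq (code_centralizer J z) by rewrite filter_uniq // parabolic_uniq.
have sHJ : perfect_centralizer Z \subset <<dset J>>%g by apply: subsetIl.
exists (dset J), Z, sigma; split=> //.
- by apply/simple_subsetsP; exists J.
- split=> [|w Tw].
    by rewrite /Z /cox_inj expgS expg1 -morphM // -decodeM (eqP zz) decode1 morph1.
  have [r wr Er] := reflections_sub sJ Tw.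
  rewrite {}wr -mem_code_reflections // in Tw *.
  have Gr : decode r \in <<dset J>>%g by rewrite mem_parabolic.
  have := allP pz r Tw; rewrite /= => /eqP zr.
  rewrite /Z /cox_inj -morphM // -morphX ?groupM //.
  have -> (x : {perm spoint}) : (x ^+ 4 = (x * x) * (x * x))%g by rewrite -mulgA.
  rewrite -!decodeM.
  by rewrite zr decode1 morph1.
- move=> w Gw.
  have /dsetP[d Ed wd] : w \in dset (parabolic J) by rewrite dset_parabolic.
  have Gzw : (decode z ^ w)%g \in <<dset J>>%g by rewrite groupJ.
  have /dsetP[c Ec zc] : (decode z ^ w)%g \in dset (parabolic J).
    by rewrite dset_parabolic.
  rewrite /Z /cox_inj -morphJ // !ext_length_inj // zc.
  rewrite !cox_lengthE ?parabolic_length //.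
  have /implyP := allP (allP mz d Ed) c Ec; apply.
  by rewrite -(inj_eq decode_inj) !decodeM -zc -wd conjgE mulKVg.
- by rewrite (induced_mask uK _ sHJ lt sigmaE).
Qed.

(** Up to twists the eight subgroups induce, in order, the linear characters, B, E, C, A, L, F and
    D. The last is the group generated by (12) and f_1 f_2. *)
Definition allowed_certs : seq (seq code * seq code * nat) :=
  let S := [:: code_s0; code_s1; code_s2] in
  let S01 := [:: code_s0; code_s1] in
  let S02 := [:: code_s0; code_s2] in
  let S12 := [:: code_s1; code_s2] in
  [seq (JK, t) | JK <-
     [:: (S, codes);
         (S01, parabolic S01);
         (S02, parabolic S02);
         (S12, parabolic S12);
         (S, [seq c <- codes | c.2 \in [:: P012; P102]]);
         (S, [seq c <- codes | eps_z c * delta_z c == 1]);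
         (S, [seq c <- codes | let: (b0, b1, b2, _) := c in
                                 (b0 == b1) && (b1 == b2)]);
         (S01, code_centralizer S01 code_s1)],
     t <- iota 0 4].

(** The identity, with centralizer W_J, yields the linear characters, B, E and C; the involution s_1
    yields D. *)
Definition perfect_certs : seq (seq code * code * nat) :=
  let S := [:: code_s0; code_s1; code_s2] in
  let S01 := [:: code_s0; code_s1] in
  let S02 := [:: code_s0; code_s2] in
  let S12 := [:: code_s1; code_s2] in
  [seq (Jz, t) | Jz <- [:: (S, code1); (S01, code1); (S02, code1); (S12, code1);
                          (S01, code_s1)],
     t <- iota 0 4].

(* [(s, t)] stands for the twist by [X t] of the sum of the characters with   *)
(* indices in [s]; twisting by omega replaces [t] by [3 - t].                 *)
Definition spec : Type := (seq nat * nat)%type.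

Definition perfect_specs : seq (seq spec) :=
  let B t := ([:: 0; 4; 6], t)%N in
  let E t := ([:: 0; 4; 6; 7; 8], t)%N in
  let C := ([:: 0; 2; 6; 7], 0)%N in
  let lin t := ([:: 0], t)%N in
  [:: [:: C; ([:: 0; 2; 4; 5; 6; 7], 1)]; [:: C; B 1; B 3];
      [:: B 2; E 1; lin 0; lin 3]; [:: E 3; B 0; lin 1; lin 2]]%N.

Definition N_specs : seq (seq spec) :=
  let A t := ([:: 0; 4], t)%N in
  let B t := ([:: 0; 4; 6], t)%N in
  let E t := ([:: 0; 4; 6; 7; 8], t)%N in
  let F t := ([:: 0; 7], t)%N in
  let L t := ([:: 0; 3], t)%N in
  let lin t := ([:: 0], t)%N in
  [:: [:: F 0; F 2; B 1; B 3]; [:: F 0; F 2; ([:: 0; 2; 4; 5; 6; 7], 1)];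
      [:: F 0; E 1; A 2; lin 3]; [:: F 0; E 1; A 3; lin 2];
      [:: B 2; E 1; L 0]; [:: E 3; F 2; A 0; lin 1];
      [:: E 3; F 2; A 1; lin 0]; [:: E 3; B 0; L 1]]%N.

Definition with_spec_twists (Fs : seq (seq spec)) : seq (seq (seq bool)) :=
  [seq [seq twisted_mask p | p <- F] | F <-
     Fs ++ [seq [seq (p.1, 3 - p.2)%N | p <- F] | F <- Fs]].

Definition model_masks : seq (seq (seq bool)) :=
  with_spec_twists perfect_specs ++ with_spec_twists N_specs.

(** * The listed families as masks, and the classification *)

Lemma values_mask m : values (mask_cf m) (fun c =>
  foldr (fun k z => (if nth false m k then nth 0 (irr_z c) k else 0) + z) 0
    (iota 0 10)).
Proof.
have V : values (mask_cf m) (fun c =>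
    \sum_(k <- iota 0 10) (if nth false m k then nth 0 (irr_z c) k else 0)).
  apply: values_sum => k; case: (nth false m k); last exact: values0.
  exact: values_irr10.
by move=> c; rewrite V unlock.
Qed.

Lemma cons_eq (T : Type) (x y : T) s1 s2 : x = y -> s1 = s2 -> x :: s1 = y :: s2.
Proof. by move=> -> ->. Qed.

Ltac solve_values :=
  first [ exact: values_eps | exact: values_delta | exact: values_U
        | exact: values_R | exact: values1
        | apply: valuesM; solve_values | apply: valuesD; solve_values ].

Lemma perfect_familiesE : with_twists perfect_families =
  map (map mask_cf) (with_spec_twists perfect_specs).
Proof.
rewrite /with_twists /perfect_families /omega_twist /=.
rewrite /charA /charB /charE /charF /charC /charD /omega.
by repeat apply: cons_eq => //;
  (apply: values_eq; [solve_values | exact: values_mask | by vm_compute]).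
Qed.

Lemma N_familiesE : with_twists N_families =
  map (map mask_cf) (with_spec_twists N_specs).
Proof.
rewrite /with_twists /N_families /omega_twist /=.
rewrite /charA /charB /charE /charF /charC /charD /charLp /charLm /omega.
by repeat apply: cons_eq => //;
  (apply: values_eq; [solve_values | exact: values_mask | by vm_compute]).
Qed.

Lemma allowed_masks_neq0 :
  all (fun m => has (fun j => nth false m j) (iota 0 10)) allowed_masks.
Proof. by vm_compute. Qed.

Lemma model_masks_size F m : F \in model_masks -> m \in F -> size m = 10.
Proof.
have /allP ok : all (all (fun m => size m == 10)) model_masks by vm_compute.
by move=> /ok/allP okF /okF/eqP.
Qed.

Lemma model_masks_allowed F m : F \in model_masks -> m \in F ->
  allowed_character B3_S (mask_cf m).
Proof.
have /allP ok : all (all [in map allowed_cert_mask allowed_certs]) model_masks.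
  by vm_compute.
have /allP certs : all allowed_cert allowed_certs by vm_compute.
by move=> /ok/allP okF /okF/mapP[c /certs/allowed_certP Am ->].
Qed.

Lemma perfect_masks_perfect F m :
  F \in with_spec_twists perfect_specs -> m \in F ->
  perfect_character B3_S (mask_cf m).
Proof.
have /allP ok : all (all [in map perfect_cert_mask perfect_certs])
    (with_spec_twists perfect_specs) by vm_compute.
have /allP certs : all perfect_cert perfect_certs by vm_compute.
by move=> /ok/allP okF /okF/mapP[c /certs/perfect_certP Am ->].
Qed.

Lemma model_masks_sum F : F \in model_masks ->
  \sum_(m <- F) mask_cf m = \sum_(i : Iirr B3) 'chi_i.
Proof.
move=> MF; apply/eqP; rewrite sum_mask_cf.
by apply/allP: F MF; vm_compute.
Qed.

Lemma qp_gelfand_model_masks (F : seq CF3) : qp_gelfand_model B3_S F ->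
  exists2 G, G \in model_masks & perm_eq F (map mask_cf G).
Proof.
case=> allowedF sumF.
have F01 phi k : phi \in F -> (k < 10)%N -> '[phi, nth 0 irr10 k] \in [:: 0; 1].
  move=> Fphi lk; have [i ki] := irrP (irr10_irr lk).
  have Cn psi : psi \in F -> '[psi, 'chi_i] \in Num.nat.
    by move=> Fpsi; rewrite Cnat_cfdot_char_irr // (allowed_char (allowedF _ Fpsi)).
  (* The multiplicity in phi and the total multiplicity in the other terms are natural numbers a and
     b with a + b = 1. *)
  have := cfdot_sum_irr lk; rewrite -sumF cfdot_suml ki (big_rem _ Fphi) /=.
  have /natrP[a ->] := Cn _ Fphi.
  have /natrP[b ->] : \sum_(psi <- rem phi F) '[psi, 'chi_i] \in Num.nat.
    by rewrite big_seq rpred_sum // => psi /mem_rem; apply: Cn.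
  move/eqP; rewrite -natrD pnatr_eq1 => ab; rewrite !inE pnatr_eq0 pnatr_eq1.
  by case: a ab => [|[|a]].
pose ms := map cf_mask F.
have Fms : F = map mask_cf ms.
  rewrite -map_comp -[LHS]map_id; apply/eq_in_map => phi Fphi.
  by rewrite /= cf_maskK // => k; apply: F01.
have Mms : all [in allowed_masks] ms.
  apply/allP=> _ /mapP[phi Fphi ->]; apply: allowed_mask (allowedF _ Fphi) _.
  by move=> k; apply: F01.
have cnt : all (fun k => count (fun m => nth false m k) ms == 1)%N (iota 0 10).
  by rewrite -sum_mask_cf -sumF; apply/eqP; rewrite [in RHS]Fms [RHS]big_map.
have /hasP[c Cc pc] :
    has (perm_eq ms) (covers allowed_masks (iota 0 10) (nseq 10 true)).
  apply: (coversP allowed_masks_neq0 _ Mms) => [//|j lj|j lj _].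
  - by rewrite nth_nseq lj; apply/eqP/(allP cnt); rewrite mem_iota.
  - by rewrite mem_iota.
have /allP/(_ c Cc)/hasP[G MG cG] : all (fun c => has (perm_eq c) model_masks)
    (covers allowed_masks (iota 0 10) (nseq 10 true)) by vm_compute.
exists G; first exact: MG.
by rewrite {1}Fms; apply: perm_map; apply: perm_trans pc cG.
Qed.

Local Close Scope ring_scope.

Theorem theorem4p10 :
  let models := with_twists perfect_families ++ with_twists N_families in
  [/\ size models = 24,
      pairwise (fun F G : seq CF3 => ~~ perm_eq F G) models,
      forall F : seq CF3,
        qp_gelfand_model B3_S F <-> exists2 G, G \in models & perm_eq F G
    & forall F : seq CF3, F \in with_twists perfect_families ->
        has_perfect_realization B3_S F].
Proof.
move=> models; rewrite {}/models N_familiesE perfect_familiesE -map_cat.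
rewrite -/model_masks.
split=> [||F|F].
- by rewrite size_map; vm_compute.
- rewrite pairwise_map.
  have : pairwise (fun F G => ~~ perm_eq F G) model_masks by vm_compute.
  apply: (sub_in_pairwise (P := [in model_masks])); last exact/allP.
  (* [cf_mask] recovers the masks, so distinctness, computed on masks, passes to families of
     characters. *)
  move=> F G MF MG /=; apply: contra => /(perm_map cf_mask).
  have id F' : F' \in model_masks -> map cf_mask (map mask_cf F') = F'.
    move=> MF'; rewrite -map_comp -[RHS]map_id; apply/eq_in_map => m F'm.
    exact: mask_cfK (model_masks_size MF' F'm).
  by rewrite !id.
- split=> [/qp_gelfand_model_masks[G MG FG]|[_ /mapP[G MG ->] FG]].
    by exists (map mask_cf G); first exact: map_f.
  split=> [phi|]; last by rewrite (perm_big _ FG) big_map model_masks_sum.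
  rewrite (perm_mem FG) => /mapP[m Gm ->]; exact: model_masks_allowed Gm.
by case/mapP=> G MG -> phi /mapP[m Gm ->]; apply: perfect_masks_perfect Gm.
Qed.
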